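(* Let $n\ge 1$ and let $A\in M_n(\mathbb{Z})$ with $\det A\neq 0$ induce an ergodic endomorphism of the torus $\mathbb{T}^n=\mathbb{R}^n/\mathbb{Z}^n$. Then there exist a constant $C>0$ and a sequence of periodic orbits $\{O_k\}_{k\in\mathbb{N}}$ of $A$ such that $$d(O_k)^n\,T(O_k)\ge C\quad\text{for all }k,\qquad\text{and}\qquad \lim_{k\to+\infty}T(O_k)=+\infty.$$
   Context: For $A\in M_n(\mathbb{Z})$ (integer $n\times n$ matrices) with $\det A\neq 0$, the induced endomorphism of $\mathbb{T}^n$ is $x\mapsto Ax \bmod 1$, also denoted $A$. It is called ergodic if it is ergodic with respect to Lebesgue (Haar) measure Leb on $\mathbb{T}^n$. The metric on $\mathbb{T}^n$ is $d(x,y)=\min\{|\tilde x-\tilde y-m| : m\in\mathbb{Z}^n\}$ for lifts $\tilde x,\tilde y\in\mathbb{R}^n$, with $|\cdot|$ the Euclidean norm. A periodic orbit $O$ is the (finite) forward orbit $\{A^ix\}_{i\ge 0}$ of a point $x$ with $A^mx=x$ for some $m\ge1$; $T(O)$ denotes its period (its cardinality), and $d(O)=\min\{d(x,y): x,y\in O,\ x\neq y\}$. *)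

(* Defs.v *)
From HB Require Import structures.
From mathcomp Require Import all_boot all_order all_algebra.
From mathcomp Require Import all_classical all_reals all_analysis.
Set Implicit Arguments. Unset Strict Implicit. Unset Printing Implicit Defensive.
Import Order.TTheory GRing.Theory Num.Theory.
Local Open Scope classical_set_scope.
Local Open Scope ring_scope.

Section Torus.
Variable R : realType.
Variable n : nat.

Definition vec := 'cV[R]_n.

Definition fract (r : R) : R := r - (Num.floor r)%:~R.

(* the fundamental domain [0,1)^n : representatives of points of T^n = R^n/Z^n *)
Definition torus : set vec := [set x | forall i, 0 <= x i 0 /\ x i 0 < 1].

Definition tmap (A : 'M[int]_n) (x : vec) : vec :=
  map_mx fract (map_mx (fun z : int => z%:~R) A *m x).

Definition tdist (x y : vec) : R :=
  inf [set r | exists m : 'cV[int]_n,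
         r = Num.sqrt (\sum_i (x i 0 - y i 0 - (m i 0)%:~R) ^+ 2)].

Definition box (a b : vec) : set vec :=
  [set x | forall i, a i 0 <= x i 0 /\ x i 0 < b i 0].
Definition vol (a b : vec) : R := \prod_i Num.max 0 (b i 0 - a i 0).

Definition leb_outer (S : set vec) : \bar R :=
  ereal_inf [set s | exists a b : nat -> vec,
      S `<=` \bigcup_k box (a k) (b k) /\
      s = \sum_(0 <= k <oo) (vol (a k) (b k))%:E]%E.

Definition borel_set (S : set vec) : Prop :=
  <<s [set B | exists a b, B = box a b] >> S.

Definition ergodic_torus (A : 'M[int]_n) : Prop :=
  forall S : set vec, S `<=` torus -> borel_set S ->
    (forall x, torus x -> (S (tmap A x) <-> S x)) ->
    leb_outer S = 0%E \/ leb_outer S = 1%E.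

Definition periodic_pt (A : 'M[int]_n) (x : vec) : Prop :=
  torus x /\ exists m : nat, (0 < m)%N /\ iter m (tmap A) x = x.

Definition torbit (A : 'M[int]_n) (x : vec) : set vec :=
  [set iter i (tmap A) x | i in [set: nat]].

Definition orbit_dist (O : set vec) : R :=
  inf [set r | exists y z, O y /\ O z /\ y <> z /\ r = tdist y z].

End Torus.

(* Main.v *)
Require Import Defs.
From HB Require Import structures.
From mathcomp Require Import all_boot all_order perm all_algebra.
From mathcomp Require Import zify ring lra.
From mathcomp Require Import all_classical all_reals all_analysis measurable_realfun.
Set Implicit Arguments. Unset Strict Implicit. Unset Printing Implicit Defensive.
Import Order.TTheory GRing.Theory Num.Theory.
Import numFieldNormedType.Exports.
Local Open Scope classical_set_scope.
Local Open Scope ring_scope.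

(* Suppose first that the characteristic polynomial f of A is irreducible, let
   p be a prime modulo which f has a simple root, lift the root to a with
   f(a) = 0 mod p^k, and let v be an integer vector, nonzero mod p, such that
   A v = a v mod p^k.  The orbit of v / p^k has period comparable to p^k,
   because a ^ (p - 1) is 1 mod p and a is not a root of unity.  If w / p^k is
   a lift of a difference of two orbit points, then A w = a w mod p^k, so
   det [w, A w, .., A^(n-1) w] is divisible by p^(k (n-1)); it is nonzero by
   irreducibility, hence |w| is at least of order p^(k (n-1) / n).

   In general A is block triangular over Z with blocks irreducible over Q.
   One uses a different prime for each block, with prime powers adjusted so
   that every block resolves distances of the same order 1 / Q, and sums the
   corresponding points.  Because of Jordan blocks v is only a generalised
   eigenvector mod p^k; the multiplicity does no harm once p is large.

   Ergodicity is used through det (A^t - 1) <> 0 for t > 0.  If u A^t = u with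
   u a nonzero integer row, the set of x such that all u A^j x are within 1/8
   of an integer is invariant, contains a cube and misses a cube. *)

(** * Integer matrices: congruences, norms, Krylov matrices *)

Definition mxdvd (m n : nat) (N : int) (M : 'M[int]_(m, n)) : Prop :=
  forall i j, (N %| M i j)%Z.

Lemma mxdvdP m n N (M : 'M[int]_(m, n)) :
  mxdvd N M <-> exists M', M = N *: M'.
Proof.
split=> [h|[M' ->] i j]; last by rewrite mxE dvdz_mulr.
exists (\matrix_(i, j) (M i j %/ N)%Z); apply/matrixP => i j.
by rewrite !mxE mulrC divzK.
Qed.

Lemma mxdvd0 m n N : mxdvd N (0 : 'M[int]_(m, n)).
Proof. by move=> i j; rewrite mxE dvdz0. Qed.

Lemma mxdvdD m n N (M M' : 'M[int]_(m, n)) :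
  mxdvd N M -> mxdvd N M' -> mxdvd N (M + M').
Proof. by move=> h h' i j; rewrite mxE rpredD. Qed.

Lemma mxdvdN m n N (M : 'M[int]_(m, n)) : mxdvd N M -> mxdvd N (- M).
Proof. by move=> h i j; rewrite mxE rpredN. Qed.

Lemma mxdvdB m n N (M M' : 'M[int]_(m, n)) :
  mxdvd N M -> mxdvd N M' -> mxdvd N (M - M').
Proof. by move=> h h'; apply: mxdvdD => //; apply: mxdvdN. Qed.

Lemma mxdvd_sum m n N (I : Type) (r : seq I) (P : pred I)
    (F : I -> 'M[int]_(m, n)) :
  (forall i, P i -> mxdvd N (F i)) -> mxdvd N (\sum_(i <- r | P i) F i).
Proof. by move=> h; elim/big_rec: _ => [|i M Pi]; [exact: mxdvd0|exact/mxdvdD/h]. Qed.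

Lemma mxdvdZl m n N (a : int) (M : 'M[int]_(m, n)) : (N %| a)%Z -> mxdvd N (a *: M).
Proof. by move=> h i j; rewrite mxE dvdz_mulr. Qed.

Lemma mxdvdZr m n N (a : int) (M : 'M[int]_(m, n)) : mxdvd N M -> mxdvd N (a *: M).
Proof. by move=> h i j; rewrite mxE dvdz_mull. Qed.

Lemma mxdvd_mull m n q N (M : 'M[int]_(m, n)) (M' : 'M[int]_(n, q)) :
  mxdvd N M' -> mxdvd N (M *m M').
Proof.
by move=> h i j; rewrite mxE; apply: rpred_sum => k _; rewrite dvdz_mull.
Qed.

Lemma mxdvd_trans m n N N' (M : 'M[int]_(m, n)) :
  (N %| N')%Z -> mxdvd N' M -> mxdvd N M.
Proof. by move=> h h' i j; apply: dvdz_trans h (h' i j). Qed.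

Lemma mxdvd_coprimeZ m n N (a : int) (M : 'M[int]_(m, n)) :
  coprimez N a -> mxdvd N (a *: M) -> mxdvd N M.
Proof. by move=> co h i j; have := h i j; rewrite mxE Gauss_dvdzr. Qed.

Lemma mxdvd_det n N (M : 'M[int]_n) (m : nat) (V : 'M[int]_(n, m)) :
  mxdvd N (M *m V) -> mxdvd N (\det M *: V).
Proof.
by move=> h; rewrite -mul_scalar_mx -mul_adj_mx -mulmxA; apply: mxdvd_mull.
Qed.

Definition mxnorm1 (m n : nat) (M : 'M[int]_(m, n)) : nat :=
  \sum_i \sum_j `|M i j|%N.

Lemma leq_entry_mxnorm1 m n (M : 'M[int]_(m, n)) i j : (`|M i j| <= mxnorm1 M)%N.
Proof. by rewrite /mxnorm1 (bigD1 i) //= (bigD1 j) //= -addnA leq_addr. Qed.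

Lemma absz_sum (I : Type) (r : seq I) (P : pred I) (F : I -> int) :
  (`|(\sum_(i <- r | P i) F i)%R| <= \sum_(i <- r | P i) `|F i|)%N.
Proof. by elim/big_rec2: _ => // i a b _ h; lia. Qed.

Lemma mxnorm1M m n q (M : 'M[int]_(m, n)) (M' : 'M[int]_(n, q)) :
  (mxnorm1 (M *m M') <= mxnorm1 M * mxnorm1 M')%N.
Proof.
rewrite /mxnorm1 big_distrl; apply: leq_sum => i _ /=.
apply: (@leq_trans (\sum_j \sum_k `|M i k| * `|M' k j|)%N).
  apply: leq_sum => j _; rewrite mxE (leq_trans (absz_sum _ _ _)) //.
  by apply: leq_sum => k _; rewrite abszM.
rewrite exchange_big big_distrl /=; apply: leq_sum => k _.
rewrite -big_distrr /= leq_mul2l; apply/orP; right.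
by rewrite [leqRHS](bigD1 k) //= leq_addr.
Qed.

Lemma leq_det n (M : 'M[int]_n) (b : nat) :
  (forall i j, (`|M i j| <= b)%N) -> (`|\det M| <= n`! * b ^ n)%N.
Proof.
move=> h; rewrite /determinant (leq_trans (absz_sum _ _ _)) //.
rewrite -card_Sn -sum_nat_const; apply: leq_sum => s _; rewrite abszMsign.
rewrite -[X in (b ^ X)%N]card_ord -prod_nat_const.
elim/big_rec2: _ => // i x y _ xy; rewrite abszM.
exact: leq_mul (h _ _) xy.
Qed.

Definition krylov n (C : 'M[int]_n) (r : 'cV[int]_n) : 'M[int]_n :=
  \matrix_(i, j) (C ^+ j *m r) i 0.

(** In positive dimension this is irreducibility of the characteristic polynomial over Q, phrased as
    cyclicity of every nonzero vector. Its negation hands over the vector [r] from which an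
    invariant sublattice is built. *)
Definition irred_mx n (C : 'M[int]_n) : Prop :=
  forall r : 'cV[int]_n, r != 0 -> \det (krylov C r) != 0.

Lemma mulmx_krylov n (B C : 'M[int]_n) (r : 'cV[int]_n) :
  B *m krylov C r = \matrix_(i, j) (B *m (C ^+ j *m r)) i 0.
Proof.
by apply/matrixP=> i j; rewrite !mxE; apply: eq_bigr => k _; rewrite !mxE.
Qed.

Lemma mulmx_det_eq0 m n (M : 'M[int]_n) (V : 'M[int]_(m, n)) :
  \det M != 0 -> V *m M = 0 -> V = 0.
Proof.
move=> d0 /(congr1 (mulmx^~ (\adj M))).
rewrite -mulmxA mul_mx_adj mul0mx mul_mx_scalar => /matrixP h.
apply/matrixP => i j; have /eqP := h i j.
by rewrite !mxE mulf_eq0 (negPf d0) => /eqP.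
Qed.

Lemma det_mulmx_eq0 m n (M : 'M[int]_n) (V : 'M[int]_(n, m)) :
  \det M != 0 -> M *m V = 0 -> V = 0.
Proof.
move=> d0 h; apply: trmx_inj; rewrite trmx0.
by apply: (@mulmx_det_eq0 _ _ M^T); rewrite ?det_tr // -trmx_mul h trmx0.
Qed.

Lemma det_eq0_cV n (M : 'M[int]_n) :
  \det M = 0 -> exists2 v : 'cV[int]_n, v != 0 & M *m v = 0.
Proof.
rewrite -det_tr => /eqP/det0P [v v0 vM].
exists v^T; first by rewrite trmx_eq0.
by apply: trmx_inj; rewrite trmx_mul trmxK trmx0.
Qed.

(** * Polynomials in an irreducible matrix *)

Section Irreducible.
Variables (d : nat) (C : 'M[int]_d.+1).
Hypothesis irrC : irred_mx C.

(** A nonzero kernel vector [w] of [q(C)] is cyclic, and [q(C)] commutes with [C], so it kills every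
    [C^j w]. *)
Lemma irred_horner_eq0 (q : {poly int}) :
  \det (horner_mx C q) = 0 -> horner_mx C q = 0.
Proof.
case/det_eq0_cV => w w0 qw; apply: (@mulmx_det_eq0 _ _ (krylov C w)).
  exact: irrC.
rewrite mulmx_krylov; apply/matrixP => i j; rewrite [LHS]mxE.
have co : horner_mx C q *m C ^+ j = C ^+ j *m horner_mx C q.
  have := comm_horner_mx2 C q ('X^j); rewrite /GRing.comm rmorphXn /= horner_mx_X.
  by move=> h; exact: h.
by rewrite mulmxA co -mulmxA qw mulmx0 !mxE.
Qed.

Lemma horner_mx_krylov (q : {poly int}) (r : 'cV[int]_d.+1) :
  (size q <= d.+1)%N ->
  horner_mx C q *m r = krylov C r *m (\col_j q`_j).
Proof.
move=> sq; rewrite -{1}(coefK q) poly_def.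
rewrite (big_ord_widen _ (fun i => q`_i *: 'X^i) sq) big_mkcond /=.
rewrite rmorph_sum mulmx_suml; apply/matrixP => i j.
rewrite (ord1 j) summxE mxE; apply: eq_bigr => k _; rewrite [X in _ = X * _]mxE.
rewrite [X in _ = _ * X]mxE.
case: ltnP => hk; last by rewrite rmorph0 mul0mx mxE nth_default // mulr0.
rewrite -mul_polyC rmorphM /= horner_mx_C rmorphXn /= horner_mx_X.
by rewrite -[_ * _]/(_ *m _) mul_scalar_mx -scalemxAl mxE mulrC.
Qed.

Lemma irred_horner_small (q : {poly int}) :
  (size q <= d.+1)%N -> horner_mx C q = 0 -> q = 0.
Proof.
move=> sq q0; have e0 : (delta_mx 0 0 : 'cV[int]_d.+1) != 0.
  by apply/eqP => /matrixP /(_ 0 0); rewrite !mxE.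
have := horner_mx_krylov (delta_mx 0 0) sq; rewrite q0 mul0mx => /esym.
move/(det_mulmx_eq0 (irrC e0)) => /matrixP h.
apply/polyP => i; rewrite coef0; case: (ltnP i d.+1) => hi.
  by have := h (Ordinal hi) 0; rewrite !mxE.
by rewrite nth_default // (leq_trans sq).
Qed.

(** The derivative is a nonzero polynomial of degree [d], too small to annihilate [C]. A prime that
    does not divide this determinant sees only simple roots. *)
Lemma irred_deriv : \det (horner_mx C (char_poly C)^`()) != 0.
Proof.
apply/eqP => /irred_horner_eq0 /irred_horner_small.
have sz := size_char_poly C; have mon := char_poly_monic C.
rewrite -ltnS -sz lt_size_deriv ?monic_neq0 // => /(_ isT) /polyP /(_ d).
move: mon; rewrite coef_deriv coef0 monicE lead_coefE sz /= => /eqP ->.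
by move/eqP; rewrite pnatr_eq0.
Qed.

(** Divide by the monic [char_poly C] as long as [f(C)] is singular: the remainder annihilates [C]
    and has degree at most [d], so it vanishes. The final cofactor [h] is coprime to [char_poly C]
    over Q. *)
Lemma irred_factor (f : {poly int}) : f != 0 ->
  exists (r : nat) (h : {poly int}),
    f = char_poly C ^+ r * h /\ \det (horner_mx C h) != 0.
Proof.
have [s] := ubnP (size f); elim: s f => // s IH f sf f0.
have [/irred_horner_eq0 fC|h] := eqVneq (\det (horner_mx C f)) 0; last first.
  by exists 0%N, f; rewrite expr0 mul1r.
have mg := char_poly_monic C.
have e := Pdiv.RingMonic.rdivp_eq mg f.
set q := Pdiv.CommonRing.rdivp _ _ in e; set t := Pdiv.CommonRing.rmodp _ _ in e.
have t0 : t = 0.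
  apply: irred_horner_small.
    by rewrite -ltnS -(size_char_poly C) Pdiv.Ring.ltn_rmodpN0 // monic_neq0.
  move: fC; rewrite e rmorphD rmorphM /= Cayley_Hamilton.
  by rewrite mulr0 add0r.
rewrite t0 addr0 in e.
have q0 : q != 0 by apply: contraNneq f0 => q0; rewrite e q0 mul0r.
have [] := IH q _ q0.
  move: sf; rewrite e size_Mmonic // size_char_poly; move: (size q); lia.
move=> r [h [qe hC]]; exists r.+1, h; split=> //.
by rewrite e qe exprS -mulrA mulrC mulrA.
Qed.

End Irreducible.

(** * Roots modulo prime powers *)

Lemma dvdz_horner_sub (g : {poly int}) (x y : int) :
  (x - y %| g.[x] - g.[y])%Z.
Proof.
elim/poly_ind: g => [|g c IH]; first by rewrite !hornerE dvdz0.
rewrite !hornerMXaddC.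
have -> : g.[x] * x + c - (g.[y] * y + c) = (g.[x] - g.[y]) * x + g.[y] * (x - y).
  by ring.
by apply: rpredD; [apply: dvdz_mulr|apply: dvdz_mull].
Qed.

(** Euclid's argument: at multiples of [g(0) * B] the value of [g] is [g(0) * u] with [u] congruent
    to 1 mod [B], so a prime factor of [u] cannot divide [B]. As [g] is not constant, some such [u]
    differs from 1. *)
Lemma exists_prime_root (g : {poly int}) (B : nat) :
  (1 < size g)%N -> g.[0] != 0 -> (0 < B)%N ->
  exists (p : nat) (a : int), [/\ prime p, ~~ (p %| B)%N & (p %| g.[a])%Z].
Proof.
move=> sg g0 B0; pose x (l : nat) := g.[0] * (3 * B * l)%N%:Z.
have x_inj : injective x.
  move=> l l' /(mulfI g0) /eqP; rewrite eqz_nat eqn_pmul2l ?muln_gt0 //.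
  by move/eqP.
have g1 : g - g.[0]%:P != 0.
  rewrite subr_eq0; apply: contraTneq sg => ->.
  by rewrite -leqNgt size_polyC; case: eqP.
have [l gl] : exists l, g.[x l] != g.[0].
  pose s := [seq x l | l <- iota 0 (size (g - g.[0]%:P))].
  have [a|/allPn[y /mapP[l _ ->] nr]] := boolP (all (root (g - g.[0]%:P)) s).
    have := max_poly_roots g1 a; rewrite map_inj_uniq ?iota_uniq // => /(_ isT).
    by rewrite size_map size_iota ltnn.
  by exists l; move: nr; rewrite rootE !hornerE subr_eq0.
have := dvdz_horner_sub g (x l) 0; rewrite subr0 => /dvdzP [q hq].
pose u := 1 + (3 * B * l)%N%:Z * q.
have gu : g.[x l] = g.[0] * u by rewrite -[LHS](subrK g.[0]) hq /x /u; ring.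
have u1 : u != 1 by apply: contra_neq gl => u1; rewrite gu u1 mulr1.
(* The factor 3 in [x] makes [u] congruent to 1 mod 3, which excludes 0 and -1. *)
have u2 : (1 < `|u|)%N.
  move: u1; rewrite /u -!mulnA PoszM.
  by set w := (B * l)%N; rewrite -mulrA; set z := _ * q; lia.
exists (pdiv `|u|), (x l); split; first exact: pdiv_prime.
  apply: contraL (pdiv_prime u2) => pB.
  have h1 : (pdiv `|u| %| u)%Z by rewrite dvdzE /= pdiv_dvd.
  have h2 : (pdiv `|u| %| u - 1)%Z.
    rewrite /u addrC addKr dvdz_mulr // dvdzE /= dvdn_mulr // dvdn_mull //.
  have : (pdiv `|u| %| u - (u - 1))%Z by apply: rpredB.
  rewrite opprB addrC subrK.
  by rewrite dvdzE /= dvdn1 => /eqP ->.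
by rewrite gu dvdz_mull // dvdzE /= pdiv_dvd.
Qed.

Lemma horner_taylor2 (g : {poly int}) (a b : int) :
  exists c, g.[a + b] = g.[a] + b * g^`().[a] + b ^+ 2 * c.
Proof.
elim/poly_ind: g => [|g e [c IH]]; first by exists 0; rewrite !hornerE /= deriv0 !hornerE; ring.
exists (c * (a + b) + g^`().[a]).
rewrite !hornerMXaddC IH derivD derivM derivX derivC !hornerE /=; ring.
Qed.

Lemma coprimez_prime (p : nat) (a : int) :
  prime p -> coprimez p a = ~~ (p %| a)%Z.
Proof. by move=> pp; rewrite coprimezE /= prime_coprime // dvdzE. Qed.

Lemma hensel (p : nat) (g : {poly int}) (a1 : int) :
  prime p -> (p %| g.[a1])%Z -> ~~ (p %| g^`().[a1])%Z ->
  forall k, exists a, (p%:Z ^+ k %| g.[a])%Z /\ (p %| a - a1)%Z.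
Proof.
move=> pp ga ga' k.
suff [a [p0 pa]] : exists a, (p%:Z ^+ k.+1 %| g.[a])%Z /\ (p %| a - a1)%Z.
  by exists a; split=> //; apply: dvdz_trans p0; apply: dvdz_exp2l.
elim: k => [|k [a [ak aa]]]; first by exists a1; rewrite subrr dvdz0 expr1.
have ndv : coprimez p g^`().[a].
  rewrite coprimez_prime //; apply: contra ga' => h.
  rewrite -(subKr g^`().[a] g^`().[a1]) rpredB //.
  by rewrite (dvdz_trans aa) // dvdz_horner_sub.
have [u [v]] := Bezoutz p g^`().[a]; move: (ndv) => /eqP -> uv.
case/dvdzP: (ak) => q hq.
(* Newton's correction: [q] is [g(a) / p^(k+1)] and [v] inverts [g'(a)] modulo [p]. *)
exists (a + p%:Z ^+ k.+1 * (- q * v)); split; last first.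
  by rewrite addrAC rpredD // dvdz_mulr // exprS dvdz_mulr.
have [c ->] := horner_taylor2 g a (p%:Z ^+ k.+1 * (- q * v)).
have -> : g.[a] + p%:Z ^+ k.+1 * (- q * v) * g^`().[a]
   + (p%:Z ^+ k.+1 * (- q * v)) ^+ 2 * c =
   p%:Z ^+ k.+2 * (q * u + p%:Z ^+ k * ((q * v) ^+ 2 * c)).
  have -> : - q * v = - (q * v) by ring.
  transitivity (p%:Z ^+ k.+1 * (q * (u * p + v * g^`().[a]) - q * v * g^`().[a]
     + p%:Z ^+ k.+1 * ((q * v) ^+ 2 * c))); first by rewrite uv hq; ring.
  rewrite !exprS; ring.
exact: dvdz_mulr.
Qed.

(** * Multiplicative orders and binomial expansions modulo prime powers *)

(** Modulo [p^2] the sum is [p + 'C(p, 2) p y], and [p] divides ['C(p, 2)] because [p] is odd. Hence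
    this factor of a [p]-th power minus 1 carries exactly one power of [p]. *)
Lemma sum_geom_prime (p : nat) (y : int) : prime p -> odd p ->
  exists z, \sum_(i < p) (1 + p%:Z * y) ^+ i = p%:Z * (1 + p%:Z * z).
Proof.
move=> pp po.
have h i : exists z, (1 + p%:Z * y) ^+ i = 1 + i%:Z * (p%:Z * y) + p%:Z ^+ 2 * z.
  elim: i => [|i [z IH]]; first by exists 0; rewrite expr0; ring.
  exists (z + i%:Z * y ^+ 2 + p%:Z * z * y); rewrite exprS IH (intS i); ring.
have hs n : exists z, \sum_(i < n) (1 + p%:Z * y) ^+ i =
    n%:Z + (\sum_(i < n) i)%N%:Z * (p%:Z * y) + p%:Z ^+ 2 * z.
  elim: n => [|n [z hz]]; first by exists 0; rewrite !big_ord0; ring.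
  have [z' hz'] := h n.
  exists (z + z'); rewrite !big_ord_recr /= hz hz' PoszD (intS n); ring.
have := hs p; rewrite -(big_mkord xpredT id) bin2_sum.
have /dvdnP [w ->] : (p %| 'C(p, 2))%N.
  by apply: prime_dvd_bin; rewrite //= ltn_neqAle prime_gt1 // andbT; case: eqP po => // <-.
by case=> z ->; exists (w%:Z * y + z); rewrite PoszM; ring.
Qed.

Lemma lifting_the_exponent (p : nat) (b : int) (c j t : nat) : prime p -> odd p ->
  (p %| b - 1)%Z -> ~~ (p%:Z ^+ c.+1 %| b - 1)%Z ->
  (p%:Z ^+ j %| b ^+ t - 1)%Z -> (p ^ (j - c) %| t)%N.
Proof.
move=> pp po b1 bc; elim: j t => [|j IH] t; first by rewrite sub0n dvd1n.
have [jc|cj] := leqP j.+1 c; first by rewrite (eqP jc) dvd1n.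
move=> pt.
have pow i : (p %| b ^+ i - 1)%Z by rewrite subrX1 dvdz_mulr.
(* Otherwise the geometric sum, congruent to [t] mod [p], is a unit, and the whole power of [p]
   divides [b - 1]. *)
have /dvdnP [t' tt] : (p %| t)%N.
  apply: contraR bc => npt; apply: dvdz_trans (dvdz_exp2l _ cj) _.
  move: pt; rewrite subrX1 Gauss_dvdzl // coprimezXl // coprimez_prime //.
  apply: contra npt => h.
  have : (p %| \sum_(i < t) b ^+ i - \sum_(i < t) (b ^+ i - 1))%Z.
    by rewrite rpredB // rpred_sum.
  by rewrite -sumrB (eq_bigr (fun=> 1)) ?sumr_const ?card_ord ?natz // => i _; ring.
move: pt; rewrite tt exprM; case/dvdzP: (pow t') => y hy.
have -> : b ^+ t' = 1 + p%:Z * y by rewrite mulrC -hy; ring.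
rewrite subrX1; have [z ->] := sum_geom_prime y pp po.
rewrite mulrA Gauss_dvdzl; last first.
  rewrite coprimezXl // coprimez_prime // rpredDr ?dvdz_mulr // dvdzE /= dvdn1.
  by case: eqP pp => // ->.
rewrite exprSr dvdz_mul2r ?eqz_nat -?lt0n ?prime_gt0 // => h.
rewrite subSn // expnSr dvdn_mul //; apply: IH.
by move: h; rewrite hy mulrC addrC addKr.
Qed.

(** From [i * 'C(t, i) = t * 'C(t - 1, i - 1)], with [i] prime to [p]. *)
Lemma dvdn_bin_prime_power (p s t i : nat) :
  prime p -> (0 < i)%N -> ~~ (p %| i)%N -> (p ^ s %| t)%N -> (p ^ s %| 'C(t, i))%N.
Proof.
move=> pp; case: i => // i _ pi pt.
have := mul_bin_diag t i; rewrite mulnC => e.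
rewrite -(@Gauss_dvdr _ i.+1) -?e ?dvdn_mull //.
by rewrite coprimeXl // prime_coprime.
Qed.

Lemma scalar_mx_exp n (a : int) t : (a%:M : 'M[int]_n) ^+ t = (a ^+ t)%:M.
Proof.
by elim: t => [|t IH]; rewrite ?expr0 // !exprS IH scalar_mxM.
Qed.

(** Expand [(a + (A - a))^t]: the terms with exponent [0 < i < r] have a binomial divisible by
    [p^s], and those with [i >= r] vanish on [v] mod [p^k]. *)
Lemma mxdvd_expB n (A : 'M[int]_n) (v : 'cV[int]_n) (a : int) (p r k s t : nat) :
  prime p -> ~~ (p %| r`!)%N -> (s <= k)%N -> (p ^ s %| t)%N ->
  mxdvd (p%:Z ^+ k) ((A - a%:M) ^+ r *m v) ->
  mxdvd (p%:Z ^+ s) ((A ^+ t - (a ^+ t)%:M) *m v).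
Proof.
move=> pp pr sk pt hv.
have co : GRing.comm a%:M (A - a%:M) by apply: comm_scalar_mx.
have {1}-> : A = a%:M + (A - a%:M) by rewrite addrC subrK.
rewrite exprDn_comm // big_ord_recl /= subn0 expr0 mulr1 bin0 mulr1n.
rewrite scalar_mx_exp addrAC subrr add0r mulmx_suml; apply: mxdvd_sum => i _.
rewrite /bump leq0n add1n -scaler_nat -scalemxAl -[_ * _ ^+ _]/(_ *m _) -mulmxA.
have [ri|ir] := leqP r i.+1.
  apply: mxdvdZr; apply: mxdvd_mull; rewrite -(subnK ri) exprD -mulmxA.
  by apply: mxdvd_mull; apply: mxdvd_trans hv; apply: dvdz_exp2l.
apply: mxdvdZl; rewrite natz dvdzE abszX /=; apply: dvdn_bin_prime_power => //.
apply: contra pr => h; apply: dvdn_trans h _; apply: dvdn_fact; lia.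
Qed.

Lemma PoszX (n k : nat) : (n ^ k)%N%:Z = n%:Z ^+ k.
Proof. by rewrite -[LHS]natz natrX natz. Qed.

Lemma fermat_int (p : nat) (a : int) :
  prime p -> odd p -> ~~ (p %| a)%Z -> (p %| a ^+ p.-1 - 1)%Z.
Proof.
move=> pp po pa; have p0 := prime_gt0 pp.
have -> : a ^+ p.-1 = (`|a| ^ p.-1)%N%:Z.
  by rewrite -abszX gez0_abs // exprn_even_ge0 //; case: p po {pp pa p0}.
have a0 : (0 < `|a|)%N by rewrite absz_gt0; apply: contraNneq pa => ->; rewrite dvdz0.
rewrite -[1]/(1%N%:Z) subzn ?expn_gt0 ?a0 //.
have /eqP := fermat_little `|a|%N pp; rewrite -{1}(prednK p0) expnS.
rewrite -[X in _ == X %[mod _]]muln1 eqn_mod_dvd; last by rewrite leq_mul // expn_gt0 a0.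
rewrite -mulnBr Gauss_dvdr ?prime_coprime // => h; by rewrite dvdzE.
Qed.

(* Once [p ^ s] divides [t], it divides the binomials ['C(t, j)], [0 < j < r],
   since [p] does not divide [r!]; so the nilpotent part of [A - a] on [v]
   contributes nothing beyond the bounded loss [c]. *)
Lemma mxdvd_gen_eigen n (A : 'M[int]_n) (v : 'cV[int]_n) (a e : int)
    (p r k c m t : nat) :
  prime p -> odd p -> ~~ (p %| r`!)%N -> ~~ (p %| a)%Z ->
  ((c < k)%N -> ~~ (p%:Z ^+ c.+1 %| a ^+ p.-1 - 1)%Z) ->
  mxdvd (p%:Z ^+ k) ((A - a%:M) ^+ r *m v) ->
  (p%:Z ^+ k %| e * (a ^+ t - 1))%Z ->
  mxdvd (p%:Z ^+ (k - c)) (e *: ((A ^+ (m + t) - A ^+ m) *m v)).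
Proof.
move=> pp po pr pa hc hv he.
have [->|e0] := eqVneq e 0; first by rewrite scale0r; apply: mxdvd0.
have [kc|ck] := leqP k c.
  by rewrite (eqP kc) expr0 => i j; rewrite dvd1z.
(* Cancelling the [p]-part [p^l] of [e] costs [l] in the exponent; multiplying by [e] at the end
   gives it back. *)
have [e' pe' ee] := pfactor_coprime pp (etrans (absz_gt0 e) e0).
set l := logn p _ in ee.
have ez : e = sgz e * e'%:Z * p%:Z ^+ l by rewrite {1}(intEsg e) {1}ee PoszM mulrA PoszX.
have h1 : (p%:Z ^+ (k - l) %| a ^+ t - 1)%Z.
  have [kl|/ltnW lk] := leqP k l; first by rewrite (eqP kl) expr0 dvd1z.
  move: he; rewrite ez -{1}(subnK lk) exprD mulrAC dvdz_mul2r; last first.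
    by rewrite expf_neq0 // eqz_nat -lt0n prime_gt0.
  rewrite Gauss_dvdzr //.
  rewrite coprimezXl // coprimez_prime // dvdzE abszM absz_sg e0 mul1n.
  by rewrite -prime_coprime.
have h2 : (p ^ (k - l - c) %| t)%N.
  apply: (@lifting_the_exponent p (a ^+ p.-1)) => //; first exact: fermat_int.
    exact: hc.
  by rewrite exprAC subrX1 dvdz_mulr.
have h3 : mxdvd (p%:Z ^+ (k - l - c)) ((A ^+ t - (a ^+ t)%:M) *m v).
  by apply: mxdvd_expB pp pr _ h2 hv; rewrite -subnDA leq_subr.
have -> : e *: ((A ^+ (m + t) - A ^+ m) *m v) =
   A ^+ m *m (e *: ((A ^+ t - (a ^+ t)%:M) *m v) + (e * (a ^+ t - 1)) *: v).
  have -> : A ^+ (m + t) - A ^+ m = A ^+ m *m (A ^+ t - 1%:M).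
    by rewrite exprD mulmxBr mulmx1.
  rewrite -mulmxA scalemxAr; congr (_ *m _).
  rewrite -scalerA -scalerDr; congr (_ *: _).
  by rewrite !mulmxBl mul1mx mul_scalar_mx scalerBl scale1r addrA subrK.
apply: mxdvd_mull; apply: mxdvdD; last first.
  by apply: mxdvdZl; apply: dvdz_trans he; apply: dvdz_exp2l; apply: leq_subr.
rewrite ez -scalerA; apply: mxdvdZr.
have [w ->] := (mxdvdP _ _).1 h3.
rewrite scalerA -exprD; apply: mxdvdZl; apply: dvdz_exp2l.
move: l {h1 h2 h3 ee ez ck hc he hv} => l; move: k c l; clear; lia.
Qed.

(** * The irreducible block *)

Lemma order_mod_prime_power (p : nat) (a : int) (c k t : nat) :
  prime p -> odd p -> ~~ (p %| a)%Z ->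
  ((c < k)%N -> ~~ (p%:Z ^+ c.+1 %| a ^+ p.-1 - 1)%Z) ->
  (p%:Z ^+ k %| a ^+ t - 1)%Z -> (p ^ (k - c) %| t)%N.
Proof.
move=> pp po pa hc h.
have [kc|ck] := leqP k c; first by rewrite (eqP kc) dvd1n.
apply: (@lifting_the_exponent p (a ^+ p.-1)) => //; first exact: fermat_int.
  exact: hc.
by rewrite exprAC subrX1 dvdz_mulr.
Qed.

Lemma dvdz_Fp (p : nat) (z : int) : prime p -> (p %| z)%Z = (z%:~R == 0 :> 'F_p).
Proof. by move=> pp; rewrite (dvdz_pcharf (pchar_Fp pp)). Qed.

Lemma char_poly_tr (R : comNzRingType) n (M : 'M[R]_n) :
  char_poly M^T = char_poly M.
Proof.
rewrite /char_poly -det_tr; congr (\det _); apply/matrixP => i j.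
by rewrite !mxE eq_sym.
Qed.

Lemma eigenvector_mod_prime n (C : 'M[int]_n) (p : nat) (a : int) :
  prime p -> (p %| (char_poly C).[a])%Z ->
  exists v : 'cV[int]_n, mxdvd p ((C - a%:M) *m v) /\ ~ mxdvd p v.
Proof.
move=> pp pa; pose Cp := map_mx (intr : int -> 'F_p) C.
have : eigenvalue Cp^T a%:~R.
  rewrite eigenvalue_root_char char_poly_tr rootE -map_char_poly.
  by rewrite horner_map -dvdz_Fp.
case/eigenvalueP => u uC u0.
have lift i : ((u 0 i : nat)%:Z)%:~R = u 0 i :> 'F_p.
  by rewrite -pmulrn natr_Zp.
exists (\col_i (u 0 i : nat)%:Z); split=> [i j|h]; last first.
  case/eqP: u0; apply/rowP => i; apply/eqP; rewrite [X in _ == X]mxE -lift -dvdz_Fp //.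
  by have := h i 0; rewrite mxE.
rewrite dvdz_Fp // mulmxBl mul_scalar_mx !mxE rmorphB rmorphM rmorph_sum /= !ord1.
have /rowP/(_ i) := uC; rewrite !mxE lift => <-.
rewrite subr_eq0; apply/eqP; apply: eq_bigr => k _.
by rewrite !mxE rmorphM /= lift mulrC.
Qed.

Lemma horner_mx_intertwine d n (P : 'M[int]_(d.+1, n.+1)) A C (q : {poly int}) :
  P *m A = C *m P -> P *m horner_mx A q = horner_mx C q *m P.
Proof.
move=> PA; elim/poly_ind: q => [|q c IH]; first by rewrite !rmorph0 mulmx0 mul0mx.
rewrite !rmorphD !rmorphM /= !horner_mx_X !horner_mx_C.
rewrite -[horner_mx A q * _]/(_ *m _) -[horner_mx C q * _]/(_ *m _).
by rewrite mulmxDr mulmxDl mulmxA IH -!mulmxA PA mul_scalar_mx mul_mx_scalar.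
Qed.

Lemma horner_mx_eigen_mod n (C : 'M[int]_n.+1) (q : {poly int}) (a N : int)
    (v : 'cV[int]_n.+1) : mxdvd N ((C - a%:M) *m v) ->
  mxdvd N (horner_mx C q *m v - q.[a] *: v).
Proof.
move=> h; have : root (q - q.[a]%:P) a by rewrite rootE !hornerE subrr.
case/factor_theorem => s hs.
have -> : horner_mx C q *m v - q.[a] *: v = horner_mx C (q - q.[a]%:P) *m v.
  by rewrite rmorphB /= horner_mx_C mulmxBl mul_scalar_mx.
rewrite hs rmorphM rmorphB /= horner_mx_X horner_mx_C -[_ * _]/(_ *m _) -mulmxA.
exact: mxdvd_mull.
Qed.

(** On [v] the matrix [q(C)] acts mod [p] as [q(a)], which cannot vanish when [q(C)] is invertible
    mod [p]. Avoiding finitely many determinants thus controls all polynomial values needed at the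
    root. *)
Lemma horner_det_mod n (C : 'M[int]_n.+1) (q : {poly int}) (a : int) (p : nat)
    (v : 'cV[int]_n.+1) : prime p -> mxdvd p ((C - a%:M) *m v) -> ~ mxdvd p v ->
  ~~ (p %| \det (horner_mx C q))%Z -> ~~ (p %| q.[a])%Z.
Proof.
move=> pp hv nv nd; apply/negP => pq; apply: nv.
apply: (@mxdvd_coprimeZ _ _ _ (\det (horner_mx C q))).
  by rewrite coprimez_prime.
apply: mxdvd_det; rewrite -[_ *m _](subrK (q.[a] *: v)); apply: mxdvdD.
  exact: horner_mx_eigen_mod.
exact: mxdvdZl.
Qed.

Lemma mxdvd_pfactor m n (p c : nat) (D : int) (V : 'M[int]_(m, n)) :
  prime p -> D != 0 -> (logn p `|D| <= c)%N ->
  mxdvd (p%:Z ^+ c.+1) (D *: V) -> mxdvd p V.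
Proof.
move=> pp D0 lc h i j; apply: contraLR lc => nd; rewrite -ltnNge.
have := h i j; rewrite mxE Gauss_dvdzl; last by rewrite coprimezXl // coprimez_prime.
by rewrite dvdzE abszX /= pfactor_dvdn // absz_gt0.
Qed.

Section Eigenvectors.
Variables (d n : nat) (C : 'M[int]_d.+1) (A : 'M[int]_n.+1).
Variables (P : 'M[int]_(d.+1, n.+1)) (S : 'M[int]_(n.+1, d.+1)).
Hypotheses (PA : P *m A = C *m P) (PS : P *m S = 1%:M).
Hypotheses (irrC : irred_mx C) (detC : \det C != 0).
Hypothesis aperC : forall m, (0 < m)%N -> \det (C ^+ m - 1) != 0.

(** With [g = char_poly C], a Hensel root [a] and [g - g(a) = (X - a) g1], the vector is [q(A)]
    applied to a lift of an eigenvector mod [p], where [q = h g1^r]. Then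
    [(X - a)^r q = h (g - g(a))^r] is [h g^r] modulo [p^k], which annihilates [A]; and [q(a)] is a
    unit, so the image under [P] survives mod [p]. *)
Lemma exists_eigenvectors (B : nat) : (0 < B)%N ->
  exists p c r : nat, [/\ prime p, odd p, ~~ (p %| B)%N, ~~ (p %| r`!)%N &
  forall k, exists (a : int) (v : 'cV[int]_n.+1),
    [/\ ~~ (p %| a)%Z,
        (c < k)%N -> ~~ (p%:Z ^+ c.+1 %| a ^+ p.-1 - 1)%Z,
        mxdvd (p%:Z ^+ k) ((A - a%:M) ^+ r *m v),
        mxdvd (p%:Z ^+ k) ((C - a%:M) *m (P *m v)) &
        ~ mxdvd p (P *m v)]].
Proof.
move=> B0; set g := char_poly C.
have [r0 [h [fh hC]]] := irred_factor irrC (monic_neq0 (char_poly_monic A)).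
have g'C := irred_deriv irrC.
(* The extra one gives [r > 0] even if [r0 = 0], so that [(X - a) q] is a multiple of [g - g(a)]. *)
pose r := r0.+1.
(* [F] keeps [Euclid_dvdM] below from splitting the factorial itself. *)
have [F hF] : exists F, F = r`! by exists r`!.
(* The factors serve, in order: the prescribed [B], oddness of [p], simplicity of the root, [h(a)] a
   unit, [a] a unit, and the binomials below [r]. *)
pose B1 := (B * 2 * `|\det (horner_mx C g^`())| * `|\det (horner_mx C h)|
   * `|\det C| * F)%N.
have [||//|p [a1 [pp pB pa1]]] := @exists_prime_root g B1.
- by rewrite size_char_poly.
- by rewrite horner_coef0 char_poly_det mulf_neq0 // signr_eq0.
- by rewrite /B1 !muln_gt0 B0 !absz_gt0 g'C hC detC hF fact_gt0.
move: pB; rewrite /B1 !Euclid_dvdM // !negb_or -!andbA => /and5P[pB p2 pg' ph /andP[pC pr]].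
rewrite hF in pr.
have po : odd p by move: p2; rewrite dvdn_prime2 //; case: (even_prime pp) => [->|].
have [v1 [hv1 nv1]] := eigenvector_mod_prime pp pa1.
have ga1' : ~~ (p %| g^`().[a1])%Z by apply: horner_det_mod hv1 nv1 _.
(* This [c] is independent of [k]: if [p^(c+1)] divided [a^(p-1) - 1], then [C^(p-1) - 1] would kill
   [P v] modulo [p^(c+1)], and its determinant would force [p] to divide [P v]. *)
exists p, (logn p `|\det (C ^+ p.-1 - 1)|), r; split=> // k.
have [a [ak aa1]] := hensel pp pa1 ga1' k.
have hav1 : mxdvd p ((C - a%:M) *m v1).
  have -> : C - a%:M = (C - a1%:M) - (a - a1)%:M by rewrite raddfB /= opprB addrA subrK.
  by rewrite mulmxBl; apply: mxdvdB => //; rewrite mul_scalar_mx; apply: mxdvdZl.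
have : root (g - g.[a]%:P) a by rewrite rootE !hornerE subrr.
case/factor_theorem => g1 hg1.
have g1a : g1.[a] = g^`().[a].
  have := congr1 (fun q => q^`().[a]) hg1.
  by rewrite derivB derivC subr0 derivM derivB derivX derivC !hornerE /= subrr mulr0 add0r => ->.
pose q := h * g1 ^+ r.
exists a, (horner_mx A q *m (S *m v1)).
have Pv : P *m (horner_mx A q *m (S *m v1)) = horner_mx C q *m v1.
  by rewrite mulmxA (horner_mx_intertwine _ PA) -mulmxA (mulmxA P) PS mul1mx.
have pqa : ~~ (p %| q.[a])%Z.
  rewrite /q hornerM horner_exp -coprimez_prime // coprimezMr coprimezXr ?andbT.
    by rewrite coprimez_prime //; apply: horner_det_mod hav1 nv1 _.
  by rewrite coprimez_prime // g1a; apply: horner_det_mod hav1 nv1 _.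
have XC m (M : 'M[int]_m.+1) : M - a%:M = horner_mx M ('X - a%:P).
  by rewrite rmorphB /= horner_mx_X horner_mx_C.
have dvdga m (M : 'M[int]_m.+1) (s t : {poly int}) (w : 'cV[int]_m.+1) :
    horner_mx M t = 0 -> mxdvd (p%:Z ^+ k) (horner_mx M (t - g.[a]%:P * s) *m w).
  move=> Mt; rewrite rmorphB rmorphM /= Mt sub0r horner_mx_C mulNmx.
  rewrite -[_ * _]/(_ *m _) mul_scalar_mx -scalemxAl.
  by apply: mxdvdN; apply: mxdvdZl.
have gC : mxdvd (p%:Z ^+ k) ((C - a%:M) *m (P *m (horner_mx A q *m (S *m v1)))).
  rewrite Pv mulmxA XC -[_ *m horner_mx C q]/(_ * _) -rmorphM /=.
  have -> : ('X - a%:P) * q = h * g1 ^+ r0 * g - g.[a]%:P * (h * g1 ^+ r0).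
    transitivity (h * g1 ^+ r0 * (g - g.[a]%:P)); last by ring.
    by rewrite hg1 /q /r exprS; ring.
  by apply: dvdga; rewrite rmorphM /= Cayley_Hamilton mulr0.
have nP : ~ mxdvd p (P *m (horner_mx A q *m (S *m v1))).
  rewrite Pv => h1; apply: nv1; apply: (@mxdvd_coprimeZ _ _ _ q.[a]).
    by rewrite coprimez_prime.
  rewrite -[_ *: _](subKr (horner_mx C q *m v1)); apply: mxdvdB => //.
  exact: horner_mx_eigen_mod.
split=> //.
- by have := horner_det_mod pp hav1 nv1 (q := 'X); rewrite horner_mx_X hornerX; apply.
- move=> ck; apply/negP => hp; apply: nP.
  have p1 : (0 < p.-1)%N by rewrite -ltnS prednK ?prime_gt0 ?prime_gt1.
  apply: (mxdvd_pfactor pp (aperC p1) (leqnn _)).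
  have Ce : C ^+ p.-1 - 1 = horner_mx C ('X ^+ p.-1 - 1).
    by rewrite rmorphB rmorphXn /= horner_mx_X rmorph1.
  apply: mxdvd_det; rewrite {2}Ce.
  set u := P *m _; rewrite -[_ *m u](subrK (('X ^+ p.-1 - 1).[a] *: u)).
  apply: mxdvdD; last first.
    apply: mxdvdZl; rewrite hornerD hornerN horner_exp hornerX hornerC.
    exact: hp.
  by apply: horner_mx_eigen_mod; apply: mxdvd_trans gC; apply: dvdz_exp2l.
- have -> : (A - a%:M) ^+ r = horner_mx A (('X - a%:P) ^+ r).
    by rewrite rmorphXn /= XC.
  rewrite mulmxA -[_ *m horner_mx A q]/(_ * _) -rmorphM /=.
  have [s hs] : exists s, (g - g.[a]%:P) ^+ r = g ^+ r - g.[a]%:P * s.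
    have := subrXX (g - g.[a]%:P) g r; set s := \sum_(_ < _) _ => e.
    exists s; apply/eqP; rewrite -subr_eq0 opprB addrA addrAC e.
    by apply/eqP; ring.
  have -> : ('X - a%:P) ^+ r * q = h * g ^+ r - g.[a]%:P * (h * s).
    transitivity (h * (g - g.[a]%:P) ^+ r); last by rewrite hs; ring.
    by rewrite hg1 exprMn /q; ring.
  apply: dvdga; have -> : h * g ^+ r = char_poly A * g by rewrite fh -/g /r exprS; ring.
  by rewrite rmorphM /= Cayley_Hamilton mul0r.
Qed.

End Eigenvectors.

(** * Size of vectors that are eigenvectors modulo [N] *)

Lemma dvdz_det_krylov d (C : 'M[int]_d.+1) (s : 'cV[int]_d.+1) (a N : int) :
  mxdvd N ((C - a%:M) *m s) -> (N ^+ d %| \det (krylov C s))%Z.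
Proof.
move=> h.
(* Multiplying by the unitriangular [T] turns column [j > 0] of the Krylov
   matrix into [C ^+ j.-1 *m ((C - a%:M) *m s)]. *)
pose T : 'M[int]_d.+1 := \matrix_(i, j) ((i == j)%:R - a * (i.+1 == j)%:R).
have detT : \det T = 1.
  rewrite -det_tr det_trig; last first.
    apply/is_trig_mxP => i j ij; rewrite !mxE -val_eqE /= gtn_eqF // sub0r.
    by rewrite gtn_eqF ?mulr0 ?oppr0 // ltnW.
  rewrite big1 // => i _; rewrite !mxE eqxx [_.+1 == _]gtn_eqF // mulr0; exact: subr0.
(* After transposition the Leibniz products run over columns: column 0 is left aside and each of the
   other [d] contributes a factor [N]. *)
rewrite -[\det _]mulr1 -detT -det_mulmx -det_tr /determinant.
apply: rpred_sum => /= sg _; apply: dvdz_mull; rewrite big_ord_recl /=.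
apply: dvdz_mull; rewrite -[X in N ^+ X]card_ord -prodr_const.
elim/big_rec2: _ => [|i x y _ xy]; first exact: dvdzz.
apply: dvdz_mul => //; rewrite !mxE.
set i' := sg _; rewrite (bigD1 (lift ord0 i)) //= (bigD1 (widen_ord (leqnSn d) i)) //=; last first.
  by rewrite -val_eqE /= /bump leq0n add1n ltn_eqF.
rewrite big1 ?addr0; last first.
  move=> j /andP[j1 j2]; rewrite !mxE (negPf j1).
  move: j1 j2; rewrite -!val_eqE /= /bump leq0n add1n eqSS => _ /negPf ->.
  by rewrite mulr0 subr0 mulr0.
have kE j : krylov C s i' j = (C ^+ j *m s) i' 0 by rewrite mxE.
have TE j j' : T j j' = (j == j')%:R - a * (j.+1 == j')%:R by rewrite mxE.
rewrite !kE !TE eqxx -!val_eqE /= /bump leq0n add1n eqxx.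
rewrite [i.+2 == _]gtn_eqF // [nat_of_ord i == _]ltn_eqF // mulr0 subr0 mulr1 mulr1 sub0r.
have -> : (C ^+ i.+1 *m s) i' 0 + (C ^+ i *m s) i' 0 * - a =
    (C ^+ i *m ((C - a%:M) *m s)) i' 0.
  rewrite mulmxBl mulmxBr mul_scalar_mx -scalemxAr exprSr -mulmxA [RHS]mxE; congr (_ + _).
  by rewrite !mxE mulrN mulrC.
exact: mxdvd_mull.
Qed.

(** The Krylov determinant is a nonzero multiple of [N^d], while its entries are linear in [s]. *)
Lemma krylov_bound d (C : 'M[int]_d.+1) : irred_mx C ->
  exists2 K : nat, (0 < K)%N & forall (a : int) (N : nat) (s : 'cV[int]_d.+1), s != 0 ->
    mxdvd N%:Z ((C - a%:M) *m s) -> (N ^ d <= K * mxnorm1 s ^ d.+1)%N.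
Proof.
move=> irrC; pose K0 := (\sum_(j < d.+1) mxnorm1 (C ^+ j))%N.
exists ((d.+1)`! * K0 ^ d.+1).+1%N => // a N s s0 h.
apply: (@leq_trans ((d.+1)`! * (K0 * mxnorm1 s) ^ d.+1)%N); last first.
  by rewrite expnMn mulnA leq_mul2r leqnSn orbT.
have lb i j : (`|krylov C s i j| <= K0 * mxnorm1 s)%N.
  rewrite mxE; apply: leq_trans (leq_entry_mxnorm1 _ _ _) _.
  apply: leq_trans (mxnorm1M _ _) _; rewrite leq_mul2r; apply/orP; right.
  by rewrite /K0 (bigD1 j) //= leq_addr.
apply: leq_trans (leq_det lb).
have := dvdz_det_krylov h; rewrite dvdzE abszX /= => /dvdn_leq; apply.
by rewrite absz_gt0 irrC.
Qed.

(** * Separated orbits of block triangular matrices *)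

(* The point is [w / N] on the torus: its period is a multiple of [M], hence
   at least [Q ^ n / c], and its distinct orbit points are at distance at least
   [1 / (c Q)] up to a dimensional constant.  The integer [B] (primes to be
   avoided) and the multiplier [e] only strengthen the induction hypothesis:
   [e] absorbs the bounded denominators left over by Jordan blocks. *)
Definition has_spaced_orbits n (A : 'M[int]_n) : Prop :=
  forall B : nat, (0 < B)%N -> exists c : nat, forall Q : nat, (0 < Q)%N ->
  exists (N M : nat) (w : 'cV[int]_n),
  [/\ (0 < N)%N, coprime N B, coprime M B, (Q ^ n <= c * M)%N &
      forall t, mxdvd N ((A ^+ t - 1) *m w) -> (M %| t)%N] /\
  forall (e : int) (m t : nat) (z : 'cV[int]_n),
    e *: ((A ^+ (m + t) - A ^+ m) *m w) - N%:Z *: z != 0 ->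
    (N <= c * Q * mxnorm1 (e *: ((A ^+ (m + t) - A ^+ m) *m w) - N%:Z *: z))%N.

Lemma mulmx_exp_intertwine m n (P : 'M[int]_(m, n)) A C t :
  P *m A = C *m P -> P *m A ^+ t = C ^+ t *m P.
Proof.
move=> h; elim: t => [|t IH]; first by rewrite !expr0 mulmx1 mul1mx.
by rewrite exprSr -[A ^+ t * A]/(_ *m _) mulmxA IH -mulmxA h mulmxA -[_ *m C]/(_ * _) -exprSr.
Qed.

Lemma mxnorm1Z m n (a : int) (M : 'M[int]_(m, n)) : mxnorm1 (a *: M) = (`|a| * mxnorm1 M)%N.
Proof.
rewrite /mxnorm1 big_distrr; apply: eq_bigr => i _; rewrite big_distrr.
by apply: eq_bigr => j _; rewrite mxE abszM.
Qed.

Section Step.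
Variables (d n n' : nat) (A : 'M[int]_n.+1) (C : 'M[int]_d.+1) (A' : 'M[int]_n').
Variables (P : 'M[int]_(d.+1, n.+1)) (S : 'M[int]_(n.+1, d.+1)).
Variables (R : 'M[int]_(n', n.+1)) (L : 'M[int]_(n.+1, n')).
Hypotheses (dim : n.+1 = (d.+1 + n')%N).
Hypotheses (PA : P *m A = C *m P) (PS : P *m S = 1%:M) (PL : P *m L = 0).
Hypotheses (AL : L *m A' = A *m L) (RL : R *m L = 1%:M).
Hypothesis (SPLR : S *m P + L *m R = 1%:M).
Hypotheses (irrC : irred_mx C) (detC : \det C != 0).
Hypothesis aperC : forall m, (0 < m)%N -> \det (C ^+ m - 1) != 0.

(** [C] acts on the quotient by the sublattice [im L = ker P], and [A'] on that sublattice. A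
    difference [y] of orbit points either has nonzero image in the quotient, where [krylov_bound]
    applies, or lies in [im L]; then the contribution of [v] is divisible by [p^(k - c0)], and
    [p^c0 * y] is handled by the induction hypothesis. *)
Lemma has_spaced_orbits_step : has_spaced_orbits A' -> has_spaced_orbits A.
Proof.
move=> IH B B0.
have [p [c0 [r [pp po pB pr eig]]]] := exists_eigenvectors PA PS irrC detC aperC B0.
have [K K0 bnd] := krylov_bound irrC.
(* Avoiding [p] keeps [N'] and [M'] coprime to the powers of [p], so that moduli and periods
   multiply. *)
have [|c' IHc] := IH (B * p)%N; first by rewrite muln_gt0 B0 prime_gt0.
(* The first summand serves the case of nonzero image in the quotient; the second serves the other
   case and the period count, for which the successor keeps it at least [p^(c0+1) * c']. *)
exists (K * mxnorm1 P + p ^ c0.+1 * c' * (mxnorm1 R).+1)%N => Q Q0.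
have [N' [M' [w' [[N'0 coN' coM' M'Q M't] lb']]]] := IHc Q Q0.
(* The largest [k] with [p^k <= Q^(d+1)]: by [krylov_bound] the ratio of [p^k] to the size of a
   nonzero [s] is then of order at most [Q]. *)
pose k := trunc_log p (Q ^ d.+1).
have QX0 : (0 < Q ^ d.+1)%N by rewrite expn_gt0 Q0.
have /andP[kQ Qk] := trunc_log_bounds (prime_gt1 pp) QX0.
rewrite -/k in kQ Qk.
have [a [v [pa ha hAv hCv nPv]]] := eig k.
rewrite coprimeMr in coN'; case/andP: coN' => coN'B coN'p.
rewrite coprimeMr in coM'; case/andP: coM' => coM'B coM'p.
(* On the torus this is the sum of [v / p^k] and [L w' / N']. *)
exists (p ^ k * N')%N, (p ^ (k - c0) * M')%N, (N'%:Z *: v + p%:Z ^+ k *: (L *m w')).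
have PX i j : P *m (A ^+ i - A ^+ j) = (C ^+ i - C ^+ j) *m P.
  by rewrite mulmxBr mulmxBl !(mulmx_exp_intertwine _ PA).
have LX i j : (A ^+ i - A ^+ j) *m L = L *m (A' ^+ i - A' ^+ j).
  by rewrite mulmxBr mulmxBl !(mulmx_exp_intertwine _ AL).
have Pw : P *m (N'%:Z *: v + p%:Z ^+ k *: (L *m w')) = N'%:Z *: (P *m v).
  by rewrite mulmxDr -!scalemxAr mulmxA PL mul0mx scaler0 addr0.
have Rw i j : R *m ((A ^+ i - A ^+ j) *m (N'%:Z *: v + p%:Z ^+ k *: (L *m w'))) =
    N'%:Z *: (R *m ((A ^+ i - A ^+ j) *m v)) + p%:Z ^+ k *: ((A' ^+ i - A' ^+ j) *m w').
  by rewrite !mulmxDr -!scalemxAr (mulmxA _ L) LX -mulmxA (mulmxA R L) RL mul1mx.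
have coN'k : coprimez (p%:Z ^+ k) N'%:Z.
  by rewrite coprimezXl // coprimezE /= coprime_sym.
(* Some coordinate of [P v] is a unit mod [p], so congruences between multiples of [P v] can be read
   on the scalars. *)
have dvdPv b : mxdvd (p%:Z ^+ k) (b *: (P *m v)) -> (p%:Z ^+ k %| b)%Z.
  have [i ni] : exists i, ~~ (p %| (P *m v) i ord0)%Z.
    apply/existsP; apply: contra_notT nPv => /existsPn h i j; rewrite ord1.
    by have := h i; rewrite negbK.
  by move=> /(_ i 0); rewrite mxE Gauss_dvdzl // coprimezXl // coprimez_prime.
have CPv t : mxdvd (p%:Z ^+ k) ((C ^+ t) *m (P *m v) - a ^+ t *: (P *m v)).
  by have := horner_mx_eigen_mod 'X^t hCv; rewrite rmorphXn /= horner_mx_X hornerXn.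
have CPvB e i j : mxdvd (p%:Z ^+ k) (e *: ((C ^+ i - C ^+ j) *m (P *m v))
     - (e * (a ^+ i - a ^+ j)) *: (P *m v)).
  rewrite -scalerA -scalerBr; apply: mxdvdZr; rewrite mulmxBl scalerBl.
  have -> x y z u : x - y - (z - u) = (x - z) - (y - u) :> 'cV[int]_d.+1.
    by rewrite !opprB addrACA [RHS]addrACA [- y + _]addrC.
  exact: mxdvdB.
have CPvB0 e i t : mxdvd (p%:Z ^+ k) (e *: ((C ^+ (i + t) - C ^+ i) *m (P *m v))) ->
    (p%:Z ^+ k %| e * (a ^+ t - 1))%Z.
  move=> h; have : (p%:Z ^+ k %| a ^+ i * (e * (a ^+ t - 1)))%Z.
    have -> : a ^+ i * (e * (a ^+ t - 1)) = e * (a ^+ (i + t) - a ^+ i).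
      by rewrite exprD; ring.
    apply: dvdPv; have := mxdvdB h (CPvB e (i + t)%N i); rewrite subKr.
    exact.
  by rewrite Gauss_dvdzr // coprimezXl // coprimezXr // coprimez_prime.
split; first split.
- by rewrite muln_gt0 expn_gt0 prime_gt0.
- by rewrite coprimeMl coN'B coprimeXl // prime_coprime.
- by rewrite coprimeMl coM'B coprimeXl // prime_coprime.
- have -> : (Q ^ n.+1 = Q ^ d.+1 * Q ^ n')%N by rewrite dim expnD.
  apply: leq_trans (leq_mul (ltnW Qk) M'Q) _.
  have le1 : (p ^ k.+1 <= p ^ c0.+1 * p ^ (k - c0))%N.
    rewrite -expnD leq_exp2l ?prime_gt1 //.
    by rewrite addSn ltnS -leq_subLR.
  apply: leq_trans (leq_mul le1 (leqnn _)) _.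
  move: (p ^ (k - c0))%N (p ^ c0.+1)%N (K * mxnorm1 P)%N (mxnorm1 R) => x y u b.
  have -> : (y * x * (c' * M') = y * c' * 1 * (x * M'))%N by ring.
  rewrite leq_mul2r; apply/orP; right.
  by apply: leq_trans (leq_addl _ _); rewrite leq_mul2l ltnS leq0n orbT.
- move=> t ht; rewrite -[1]/(A ^+ 0) in ht.
  rewrite Gauss_dvd; last by rewrite coprimeXl // coprime_sym.
  rewrite PoszM PoszX in ht.
  apply/andP; split.
    apply: (order_mod_prime_power pp po pa ha); rewrite -[_ - 1]mul1r.
    apply: (CPvB0 1 0%N); rewrite scale1r add0n.
    apply: (mxdvd_coprimeZ coN'k).
    rewrite scalemxAr -Pw mulmxA -PX -mulmxA; apply: mxdvd_mull.
    by apply: mxdvd_trans ht; apply: dvdz_mulr.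
  apply: M't; apply: (@mxdvd_coprimeZ _ _ _ (p%:Z ^+ k)).
    by rewrite coprimez_sym.
  have h1 : mxdvd N' (R *m ((A ^+ t - A ^+ 0) *m (N'%:Z *: v + p%:Z ^+ k *: (L *m w')))).
    by apply: mxdvd_mull; apply: mxdvd_trans ht; apply: dvdz_mull.
  rewrite Rw in h1; rewrite -[1]/(A' ^+ 0).
  rewrite -[_ *: _](addKr (N'%:Z *: (R *m ((A ^+ t - A ^+ 0) *m v)))) addrC.
  by apply: mxdvdB => //; apply: mxdvdZl.
move=> e m t z; set y := _ - _ => y0.
set s := e *: ((C ^+ (m + t) - C ^+ m) *m (P *m v)) - p%:Z ^+ k *: (P *m z).
have Py : P *m y = N'%:Z *: s.
  rewrite /y mulmxBr -!scalemxAr mulmxA PX -mulmxA Pw -scalemxAr PoszM PoszX.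
  by rewrite scalerBr !scalerA (mulrC e) (mulrC N'%:Z (p%:Z ^+ k)).
have [s0|s0] := eqVneq s 0.
  have ek : (p%:Z ^+ k %| e * (a ^+ t - 1))%Z.
    apply: (CPvB0 e m); rewrite -[_ *: _](subrK (p%:Z ^+ k *: (P *m z))) -/s s0 add0r.
    by apply: mxdvdZl.
  have /mxdvdP [z1 hz1] := mxdvd_gen_eigen m pp po pr pa ha hAv ek.
  have yL : y = L *m (R *m y).
    rewrite mulmxA -[LHS]mul1mx -SPLR mulmxDl -(mulmxA S) Py s0 scaler0 mulmx0.
    by rewrite add0r.
  (* The multiplier becomes [p^c0 * e]. Since [p^c0 * p^(k - c0) = p^k * p^(c0 - k)] with truncated
     subtraction, [k < c0] needs no separate case. *)
  pose z' := p%:Z ^+ c0 *: (R *m z) - p%:Z ^+ (c0 - k) *: (R *m z1).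
  pose y' := (p%:Z ^+ c0 * e) *: ((A' ^+ (m + t) - A' ^+ m) *m w') - N'%:Z *: z'.
  have py : p%:Z ^+ k *: y' = p%:Z ^+ c0 *: (R *m y).
    rewrite /y /y' /z' mulmxBr -!scalemxAr Rw [e *: (_ + _)]scalerDr -addrA [RHS]scalerDr.
    have -> : p%:Z ^+ c0 *: (e *: (N'%:Z *: (R *m ((A ^+ (m + t) - A ^+ m) *m v)))) =
       p%:Z ^+ k *: (N'%:Z *: (p%:Z ^+ (c0 - k) *: (R *m z1))).
      have -> : e *: (N'%:Z *: (R *m ((A ^+ (m + t) - A ^+ m) *m v))) =
          N'%:Z *: (R *m (e *: ((A ^+ (m + t) - A ^+ m) *m v))).
        by rewrite -scalemxAr !scalerA mulrC.
      rewrite hz1 -scalemxAr !scalerA; congr (_ *: _).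
      rewrite mulrAC [RHS]mulrAC -!exprD; congr (_ ^+ _ * _).
      by rewrite -!maxnE maxnC.
    rewrite PoszM PoszX.
    move: (R *m z) (R *m z1) (_ *m w') (_ ^+ k) (_ ^+ c0) (_ ^+ (c0 - k)).
    by move=> x1 x2 x3 q1 q2 q3; apply/matrixP => i j; rewrite !mxE; ring.
  have pX0 i : p%:Z ^+ i != 0 by rewrite expf_neq0 // eqz_nat -lt0n prime_gt0.
  have Ry0 : R *m y != 0 by apply: contraNneq y0 => Ry0; rewrite yL Ry0 mulmx0.
  have y'0 : y' != 0.
    apply: contraNneq Ry0 => y'0; move: py; rewrite y'0 scaler0 => /esym/eqP.
    by rewrite scalemx_eq0 (negPf (pX0 _)).
  have := lb' _ _ _ _ y'0; rewrite -/y' => lb.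
  have := congr1 (@mxnorm1 _ _) py; rewrite !mxnorm1Z !abszX /= => npy.
  have h1 : (p ^ k * N' <= c' * Q * (p ^ c0 * (mxnorm1 R * mxnorm1 y)))%N.
    apply: (leq_trans (leq_mul (leqnn _) lb)); rewrite mulnCA npy.
    by rewrite !leq_mul2l mxnorm1M !orbT.
  apply: (leq_trans h1); rewrite expnS.
  move: (mxnorm1 R) (mxnorm1 y) (p ^ c0)%N (K * mxnorm1 P)%N (prime_gt0 pp) => x1 x2 x3 x4.
  move: (p) => q; clear; nia.
have hs : mxdvd (p ^ k)%N%:Z ((C - a%:M) *m s).
  rewrite PoszX /s mulmxBr -!scalemxAr; apply: mxdvdB; last by apply: mxdvdZl.
  apply: mxdvdZr; rewrite (mulmxA (C - a%:M)).
  have -> : (C - a%:M) *m (C ^+ (m + t) - C ^+ m) = (C ^+ (m + t) - C ^+ m) *m (C - a%:M).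
    have co i : GRing.comm (C - a%:M) (C ^+ i).
      apply/commrX/commr_sym/commrB; first exact: commr_refl.
      exact/commr_sym/comm_scalar_mx.
    exact: commrB (co _) (co _).
  by rewrite -mulmxA; apply: mxdvd_mull.
have h1 : (p ^ k <= K * Q * mxnorm1 s)%N.
  rewrite -(leq_exp2r _ _ (ltn0Sn d)) expnS.
  apply: leq_trans (leq_mul kQ (bnd _ _ _ s0 hs)) _.
  rewrite !expnMn mulnCA mulnA; apply: leq_mul => //; apply: leq_mul => //.
  by rewrite expnS leq_pmulr // expn_gt0 K0.
have := mxnorm1M P y; rewrite Py mxnorm1Z /= => h2.
apply: (@leq_trans (K * Q * (mxnorm1 P * mxnorm1 y))%N).
  apply: leq_trans (leq_mul h1 (leqnn N')) _.
  by rewrite -mulnA leq_mul2l [(_ * N')%N]mulnC h2 orbT.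
move: (mxnorm1 R) (mxnorm1 P) (mxnorm1 y) (p ^ c0.+1)%N => x1 x2 x3 x4; clear; nia.
Qed.

End Step.

(** * Splitting off an irreducible quotient over the integers *)

(** [row_mx S L] and [col_mx P R] are mutually inverse integer base changes making [A] block
    triangular with quotient block [C]. Keeping the four blocks and the equation of dimensions apart
    avoids casts. *)
Definition split_quotient m d (A : 'M[int]_m) (C : 'M[int]_d) : Prop :=
  exists (n : nat) (P : 'M[int]_(d, m)) (S : 'M[int]_(m, d))
    (R : 'M[int]_(n, m)) (L : 'M[int]_(m, n)),
  [/\ m = (d + n)%N, P *m A = C *m P, P *m S = 1%:M & P *m L = 0] /\
  R *m L = 1%:M /\ S *m P + L *m R = 1%:M.

Lemma split_quotient_refl m (A : 'M[int]_m) : split_quotient A A.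
Proof.
exists 0%N, 1%:M, 1%:M, 0, 0; rewrite addn0 !mul1mx mulmx1 mulmx0 mulmx0 addr0.
by do 2?split=> //; apply/matrixP => [[]].
Qed.

Lemma split_quotient_trans m d d' (A : 'M[int]_m) (C : 'M[int]_d)
    (C' : 'M[int]_d') :
  split_quotient A C -> split_quotient C C' -> split_quotient A C'.
Proof.
case=> n [P [S [R [L [[e PA PS PL] [RL SL]]]]]].
case=> n' [P' [S' [R' [L' [[e' PA' PS' PL'] [RL' SL']]]]]].
have RS : R *m S = 0.
  have := congr1 (mulmx R) SL; rewrite mulmxDr (mulmxA R L) RL mul1mx mulmx1.
  move/(canRL (addrK _)); rewrite subrr mulmxA => /(congr1 (mulmx^~ S)).
  by rewrite -mulmxA PS mulmx1 mul0mx.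
have RS' : R' *m S' = 0.
  have := congr1 (mulmx R') SL'; rewrite mulmxDr (mulmxA R' L') RL' mul1mx mulmx1.
  move/(canRL (addrK _)); rewrite subrr mulmxA => /(congr1 (mulmx^~ S')).
  by rewrite -mulmxA PS' mulmx1 mul0mx.
exists (n' + n)%N, (P' *m P), (S *m S'), (col_mx (R' *m P) R), (row_mx (S *m L') L).
split; first split.
- by rewrite e e' addnA.
- by rewrite -mulmxA PA mulmxA PA' -mulmxA.
- by rewrite -mulmxA (mulmxA P) PS mul1mx.
- rewrite mul_mx_row -mulmxA (mulmxA P) PS mul1mx PL' -mulmxA PL mulmx0.
  exact: row_mx0.
split.
  rewrite mul_col_row -!mulmxA (mulmxA P) PS PL !mul1mx mulmx0 RL' RL.
  by rewrite (mulmxA R) RS mul0mx -scalar_mx_block.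
rewrite mul_row_col -!mulmxA addrA -mulmxDr (mulmxA S') (mulmxA L') -mulmxDl.
by rewrite SL' mul1mx.
Qed.

(** If [x] kills all columns [C^j r], then by Cayley-Hamilton it also kills the next power. *)
Lemma krylov_ker_stable d (C : 'M[int]_d) (r : 'cV[int]_d) (x : 'rV[int]_d) :
  x *m krylov C r = 0 -> x *m C *m krylov C r = 0.
Proof.
case: d C r x => [|d] C r x h; first by apply/matrixP => i [].
have h1 (q : {poly int}) : (size q <= d.+1)%N -> x *m (horner_mx C q *m r) = 0.
  by move=> sq; rewrite horner_mx_krylov // mulmxA h mul0mx.
have h2 (j : nat) : (j <= d.+1)%N -> x *m (C ^+ j *m r) = 0.
  move=> jd; have -> : C ^+ j = horner_mx C 'X^j by rewrite rmorphXn /= horner_mx_X.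
  move: jd; rewrite leq_eqVlt => /orP[/eqP ->|jd]; last by rewrite h1 // size_polyXn.
  rewrite -[X in horner_mx C X](subrK (char_poly C)) rmorphD /= Cayley_Hamilton addr0.
  apply: h1; have mon := char_poly_monic C; have sz := size_char_poly C.
  apply/leq_sizeP => j' hj; rewrite coefB coefXn.
  move: hj; rewrite leq_eqVlt => /orP[/eqP <-|hj].
    by move: mon; rewrite monicE lead_coefE sz => /eqP ->; rewrite eqxx subrr.
  by rewrite gtn_eqF // nth_default ?subrr // sz.
rewrite -mulmxA mulmx_krylov; apply/matrixP => i j.
transitivity ((x *m (C ^+ j.+1 *m r)) i 0); last by rewrite h2 ?ltn_ord // !mxE.
rewrite mxE [RHS]mxE; apply: eq_bigr => k _; congr (_ * _).
by rewrite mxE exprS mulmxA.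
Qed.

Lemma split_quotient_smith r d (C K L D R : 'M[int]_(r + d)) :
  L \in unitmx -> R \in unitmx -> K = L *m D *m R ->
  (forall i j, i != j -> D i j = 0) -> (forall i, D (lshift d i) (lshift d i) != 0) ->
  (forall i, D (rshift r i) (rshift r i) = 0) ->
  (forall x : 'rV[int]_(r + d), x *m K = 0 -> x *m C *m K = 0) ->
  exists C' : 'M[int]_d, split_quotient C C'.
Proof.
move=> uL uR eK D0 Dl Dr Kst.
pose V := dsubmx (invmx L).
have VLr : V *m L = row_mx 0 1%:M.
  by rewrite mul_dsub_mx mulVmx // scalar_mx_block block_mxEv col_mxKd.
have VK : V *m K = 0.
  rewrite eK !mulmxA VLr; suff -> : row_mx 0 1%:M *m D = 0 by rewrite mul0mx.
  apply/matrixP => i j; rewrite !mxE; apply: big1 => k _; rewrite mxE.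
  case: splitP => k' ek; rewrite !mxE ?mul0r //.
  have [_|_] := eqVneq i k'; last by rewrite mul0r.
  rewrite mul1r; have -> : k = rshift r k' by apply: val_inj.
  by have [<-|/D0 //] := eqVneq (rshift r k') j.
have VCK : V *m C *m K = 0.
  apply/row_matrixP => i; rewrite !row_mul row0 Kst // -row_mul VK row0 //.
have VCLD : V *m C *m L *m D = 0.
  move: VCK; rewrite eK !mulmxA => /(congr1 (mulmx^~ (invmx R))).
  by rewrite mulmxK // mul0mx.
have lV : lsubmx (V *m C *m L) = 0.
  apply/matrixP => i j; have /matrixP/(_ i (lshift d j)) := VCLD.
  rewrite mxE (bigD1 (lshift d j)) //= big1 ?addr0; last first.
    by move=> k /D0 ->; rewrite mulr0.
  by move/eqP; rewrite !mxE mulf_eq0 (negPf (Dl j)) orbF => /eqP.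
exists (rsubmx (V *m C *m L)), r, V, (rsubmx L), (usubmx (invmx L)), (lsubmx L).
split; first split.
- by rewrite addnC.
- rewrite -[LHS](mulmxK uL) -{1}[V *m C *m L]hsubmxK lV.
  by rewrite -{1}[invmx L]vsubmxK mul_row_col mul0mx add0r.
- by move: VLr; rewrite -{1}(hsubmxK L) mul_mx_row => /eq_row_mx [].
- by move: VLr; rewrite -{1}(hsubmxK L) mul_mx_row => /eq_row_mx [].
split.
  have : usubmx (invmx L) *m L = row_mx 1%:M 0.
    by rewrite mul_usub_mx mulVmx // scalar_mx_block block_mxEv col_mxKu.
  by rewrite -{2}(hsubmxK L) mul_mx_row => /eq_row_mx [].
by rewrite addrC -mul_row_col hsubmxK vsubmxK mulmxV.
Qed.

Lemma reducible_split_quotient d (C : 'M[int]_d) (r : 'cV[int]_d) :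
  r != 0 -> \det (krylov C r) = 0 ->
  exists (d' : nat) (C' : 'M[int]_d'), (0 < d' < d)%N /\ split_quotient C C'.
Proof.
move=> r0 dK; have [L uL [R uR [s ss eK]]] := int_Smith_normal_form (krylov C r).
set D := \matrix_(i, j) _ in eK.
have dD : \det D = \prod_(i < d) s`_i.
  rewrite det_trig; last first.
    by apply/is_trig_mxP => i j ij; rewrite mxE ltn_eqF.
  by apply: eq_bigr => i _; rewrite mxE eqxx.
(* Beyond the end of [s] the default value is 0. By the divisibility chain zeros persist, so the
   first zero index [k] is the rank of the Krylov matrix; [r != 0] and the zero determinant give
   [0 < k < d]. *)
have zs : exists i, s`_i == 0 by exists (size s); rewrite nth_default.
have sz i j : (i <= j)%N -> s`_i = 0 -> s`_j = 0.
  move=> ij si; have [js|] := ltnP j (size s); last exact: nth_default.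
  have := sorted_leq_nth dvdz_trans dvdzz 0 ss.
  move=> /(_ i j); rewrite !inE si => /(_ (leq_ltn_trans ij js) js ij).
  by rewrite dvd0z => /eqP.
case: (ex_minnP zs) => k /eqP sk kmin.
have kd : (k < d)%N.
  rewrite ltnNge; apply/negP => dk.
  have : \det (krylov C r) != 0.
    rewrite eK !det_mulmx !mulf_neq0 //.
    - by apply: contraTneq uL; rewrite unitmxE => ->; rewrite unitr0.
    - rewrite dD; apply/prodf_neq0 => i _; apply/negP => /kmin.
      by rewrite leqNgt (leq_trans (ltn_ord i)).
    by apply: contraTneq uR; rewrite unitmxE => ->; rewrite unitr0.
  by rewrite dK eqxx.
have k0 : (0 < k)%N.
  rewrite lt0n; apply: contraNneq r0 => k0; rewrite k0 in sk.
  have D0 : D = 0.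
    by apply/matrixP => i j; rewrite !mxE (sz 0%N) // mul0rn.
  move: eK; rewrite D0 mulmx0 mul0mx => /matrixP K0.
  apply/eqP/matrixP => i j; have := K0 i (Ordinal (leq_ltn_trans (leq0n k) kd)).
  by rewrite mxE /= expr0 mul1mx !ord1 => ->; rewrite !mxE.
have e : d = (k + (d - k))%N by rewrite subnKC // ltnW.
exists (d - k)%N.
have Kst (x : 'rV[int]_d) := @krylov_ker_stable _ C r x.
have D0 i j : i != j -> D i j = 0 by rewrite mxE -val_eqE /= => /negPf ->.
have Dl (i : 'I_d) : (i < k)%N -> D i i != 0.
  by move=> ik; rewrite mxE eqxx; apply/negP => /kmin; rewrite leqNgt ik.
have Dr (i : 'I_d) : (k <= i)%N -> D i i = 0.
  by move=> ki; rewrite mxE eqxx (sz k).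
suff [C' h] : exists C' : 'M[int]_(d - k), split_quotient C C'.
  by exists C'; split=> //; rewrite subn_gt0 kd ltn_subrL k0 (leq_ltn_trans _ kd).
(* Naming [d - k] lets [d] be replaced by [k + l] in the matrix types. *)
have [l el] : exists l, l = (d - k)%N by exists (d - k)%N.
move: e {dK r0 dD kd k0 ss}; rewrite -el => e.
move: (krylov C r) eK Kst => K eK Kst; clearbody D.
move: C L R D K {el} uL uR eK Kst D0 Dl Dr; rewrite e.
move=> C L R D K uL uR eK Kst D0 Dl Dr.
apply: (split_quotient_smith uL uR eK D0 _ _ Kst) => i.
  by apply: Dl; rewrite /= ltn_ord.
by apply: Dr; rewrite /= leq_addr.
Qed.

(** Descent on the dimension: a quotient that is not irreducible has a smaller nonzero quotient. *)
Lemma exists_irred_quotient m (A : 'M[int]_m.+1) :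
  exists (d : nat) (C : 'M[int]_d.+1), irred_mx C /\ split_quotient A C.
Proof.
have main d (C : 'M[int]_d) : (0 < d)%N -> split_quotient A C ->
   exists (d : nat) (C : 'M[int]_d.+1), irred_mx C /\ split_quotient A C.
  have [k] := ubnP d; elim: k d C => // k IH d C dk d0 AC.
  have [irr|] := EM (irred_mx C).
    by case: d C AC irr {dk} d0 => // d C AC irr _; exists d, C.
  move/existsNP => [r /not_implyP [r0 /negP]]; rewrite negbK => /eqP dK.
  have [d' [C' [/andP[d'0 d'd] CC']]] := reducible_split_quotient r0 dK.
  apply: (IH _ C') => //; first by apply: leq_trans d'd _.
  exact: split_quotient_trans AC CC'.
exact: (main _ A _ (split_quotient_refl A)).
Qed.

Lemma det_left_quotient m d (X : 'M[int]_m) (Y : 'M[int]_d) P S :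
  P *m X = Y *m P -> P *m S = 1%:M -> \det X != 0 -> \det Y != 0.
Proof.
move=> PX PS dX; apply/negP => /det0P [x x0 xY]; case/eqP: x0.
rewrite -[x]mulmx1 -PS mulmxA (_ : x *m P = 0) ?mul0mx //.
by apply: (mulmx_det_eq0 dX); rewrite -mulmxA PX mulmxA xY mul0mx.
Qed.

Lemma det_right_sub m d (X : 'M[int]_m) (Y : 'M[int]_d) L R :
  L *m Y = X *m L -> R *m L = 1%:M -> \det X != 0 -> \det Y != 0.
Proof.
move=> LY RL dX; rewrite -det_tr; apply: (@det_left_quotient _ _ X^T _ L^T R^T).
- by rewrite -!trmx_mul LY.
- by rewrite -trmx_mul RL trmx1.
- by rewrite det_tr.
Qed.

Lemma spaced_orbits m (A : 'M[int]_m) : \det A != 0 ->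
  (forall t, (0 < t)%N -> \det (A ^+ t - 1) != 0) -> has_spaced_orbits A.
Proof.
have [k] := ubnP m; elim: k m A => // k IH [|m] A mk dA aA.
  move=> B B0; exists 1%N => Q Q0; exists 1%N, 1%N, 0; split.
    by rewrite !coprime1n expn0; split=> // t; rewrite dvd1n.
  by move=> e i t z /eqP []; apply/matrixP => [[]].
have [d [C [irr [n [P [S [R [L [[e PA PS PL] [RL SL]]]]]]]]]] := exists_irred_quotient A.
(* The restriction of [A] to [ker P]: [L R = 1 - S P], and [P A L = C P L = 0]. *)
pose A' := R *m A *m L.
have AL : L *m A' = A *m L.
  rewrite /A' !mulmxA (canRL (addKr _) SL) addrC mulmxBl mul1mx mulmxBl.
  by rewrite -!mulmxA (mulmxA P) PA -(mulmxA C) PL !mulmx0 subr0.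
have pw t : (0 < t)%N -> \det (A ^+ t - 1) != 0 by apply: aA.
apply: (has_spaced_orbits_step e PA PS PL AL RL SL irr).
- exact: det_left_quotient PA PS dA.
- move=> t t0; apply: det_left_quotient PS (aA t t0).
  by rewrite mulmxBr mulmxBl (mulmx_exp_intertwine _ PA) mulmx1 mul1mx.
apply: IH; first by move: mk; rewrite e; clear; lia.
  exact: det_right_sub AL RL dA.
move=> t t0; apply: det_right_sub RL (aA t t0).
by rewrite mulmxBr mulmxBl (mulmx_exp_intertwine _ AL) mulmx1 mul1mx.
Qed.

(** * Ergodicity *)

Section Volume.
Local Open Scope ereal_scope.

(* Integrating the last coordinate away turns an [n.+1]-dimensional weighted
   cover into an [n]-dimensional one, so Fubini is not needed. *)
Lemma weighted_cover_volume (R : realType) (l : R) (n : nat)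
    (a b : nat -> nat -> R) (w : nat -> \bar R) :
  (0 < l)%R -> (forall k, 0 <= w k) ->
  (forall x : nat -> R, (forall i, (i < n)%N -> (0 <= x i < l)%R) ->
    1 <= \sum_(0 <= k <oo)
      w k * (\prod_(i < n) \1_(`[a k i, b k i[%classic : set R) (x i))%R%:E) ->
  (l ^+ n)%R%:E <=
    \sum_(0 <= k <oo) w k * (\prod_(i < n) Num.max 0 (b k i - a k i))%R%:E.
Proof.
move=> l0; elim: n w => [|n IH] w w0 cov.
  have := cov (fun=> 0%R) (fun i (h : (i < 0)%N) => False_ind _ (notF h)).
  rewrite expr0; under eq_eseriesr do rewrite big_ord0.
  by under [in X in _ -> X]eq_eseriesr do rewrite big_ord0.
pose D := `[0%R, l[%classic : set R.
have mD : measurable D by exact: measurable_itv.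
have muD : lebesgue_measure D = l%:E.
  by rewrite /D lebesgue_measure_itv /= lte_fin l0 sube0.
have vol0 m k : (0 <= \prod_(i < m) Num.max 0 (b k i - a k i) :> R)%R.
  by apply: prodr_ge0 => i _; rewrite le_max lexx.
pose c k := w k * (\prod_(i < n) Num.max 0 (b k i - a k i))%R%:E.
have c0 k : 0 <= c k by rewrite mule_ge0 // lee_fin.
pose I k := \1_(`[a k n, b k n[%classic : set R) : R -> R.
(* Freeze the last coordinate at [y] and absorb its indicator into the weights; the induction
   hypothesis bounds each slice. *)
have stepy y : D y -> (l ^+ n)%R%:E <= \sum_(0 <= k <oo) c k * (I k y)%:E.
  rewrite /D /= in_itv /= => yD.
  rewrite (_ : \sum_(0 <= k <oo) _ = \sum_(0 <= k <oo) (w k * (I k y)%:E)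
     * (\prod_(i < n) Num.max 0 (b k i - a k i))%R%:E); last first.
    by apply: eq_eseriesr => k _; rewrite /c muleAC.
  apply: IH => [k|x xn]; first by rewrite mule_ge0 // lee_fin.
  pose x' i := if (i < n)%N then x i else y.
  have := cov x'; rewrite (_ : \sum_(0 <= k <oo) _ = \sum_(0 <= k <oo)
      (w k * (I k y)%:E) *
      (\prod_(i < n) \1_(`[a k i, b k i[%classic : set R) (x i))%R%:E); last first.
    apply: eq_eseriesr => k _; rewrite big_ord_recr /= /x' ltnn EFinM muleCA muleC.
    rewrite -muleA [RHS]muleAC -muleA; congr (_ * _); rewrite muleC; congr (_ * _).
    by congr EFin; apply: eq_bigr => i _; rewrite ltn_ord.
  apply=> i; rewrite ltnS leq_eqVlt /x' => /orP[/eqP ->|h]; first by rewrite ltnn.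
  by rewrite h xn.
pose J k : R -> \bar R := fun y => (I k y)%:E.
have mI k : measurable_fun D (J k).
  by apply/measurable_EFinP; apply: measurable_indic; exact: measurable_itv.
have cI0 k y : 0 <= c k * J k y by rewrite mule_ge0 // lee_fin.
have mc k : measurable_fun D (fun y : R => c k * J k y) by apply: emeasurable_funM.
have h1 : (l ^+ n.+1)%R%:E <= \int[lebesgue_measure]_(y in D) \sum_(0 <= k <oo) c k * J k y.
  have -> : (l ^+ n.+1)%R%:E = \int[lebesgue_measure]_(y in D) cst (l ^+ n)%R%:E y.
    transitivity ((l ^+ n)%R%:E * lebesgue_measure D).
      by rewrite muD -EFinM exprSr.
    exact/esym/integral_cst.
  have f0 (y : R) : D y -> 0 <= cst (l ^+ n)%R%:E y.
    by move=> _; rewrite lee_fin exprn_ge0 // ltW.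
  have F0 (y : R) : D y -> 0 <= \sum_(0 <= k <oo) c k * J k y.
    by move=> _; apply: nneseries_ge0.
  have mF : measurable_fun D (fun y : R => \sum_(0 <= k <oo) c k * J k y).
    apply: ge0_emeasurable_sum => [k x _ _|k _]; first exact: cI0.
    exact: mc.
  by apply: ge0_le_integral => //.
apply: (le_trans h1); rewrite integral_nneseries //.
apply: lee_nneseries => [k _ _|k _]; first by apply: integral_ge0.
have J0 (y : R) : D y -> 0 <= J k y by rewrite lee_fin.
rewrite (@ge0_integralZl _ _ _ lebesgue_measure _ mD (J k) (mI k) (c k) J0 (c0 k)).
rewrite big_ord_recr /= EFinM muleA; apply: lee_wpmul2l => //.
have mI' : measurable (`[a k n, b k n[%classic : set R) by exact: measurable_itv.
rewrite [leLHS](integral_indic lebesgue_measure mD mI').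
apply: (@le_trans _ _ (lebesgue_measure (`[a k n, b k n[%classic : set R))).
  by apply: le_measure; rewrite ?inE //; apply: measurableI.
rewrite lebesgue_measure_itv /= lte_fin; case: ifPn => ab.
  by rewrite -EFinB lee_fin le_max lexx orbT.
by rewrite lee_fin le_max lexx.
Qed.

End Volume.

Lemma leb_outer_ge_cube (R : realType) (n : nat) (l : R) (S : set (vec R n)) :
  0 < l -> (forall x : vec R n, (forall i, 0 <= x i 0 < l) -> S x) ->
  ((l ^+ n)%:E <= leb_outer S)%E.
Proof.
move=> l0 lS; apply/ereal_infP => s [a [b [cov ->]]].
(* Vectors are extended by 0 to sequences, the form in which the induction on dimension was run. *)
pose ext (v : vec R n) i := oapp (fun j : 'I_n => v j 0) 0 (insub i).
have extE v (i : 'I_n) : ext v i = v i 0 by rewrite /ext valK.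
rewrite (_ : \sum_(0 <= k <oo) _ = \sum_(0 <= k <oo) (1 *
    (\prod_(i < n) Num.max 0 (ext (b k) i - ext (a k) i))%:E))%E; last first.
  apply: eq_eseriesr => k *; rewrite mul1e; congr EFin.
  by apply: eq_bigr => i _; rewrite !extE.
apply: (@weighted_cover_volume R l n (fun k => ext (a k)) (fun k => ext (b k))
  (fun=> 1%E)) => // x hx.
have [|k _ kx] := cov (\col_i x i); first by apply: lS => i; rewrite mxE hx.
apply: (le_trans _ (nneseries_lim_ge k.+1 _)); last first.
  by move=> k' _ _; rewrite mul1e lee_fin; apply: prodr_ge0.
rewrite big_nat_recr //= mul1e [\prod_(i < n) _]big1; last first.
  move=> i _; rewrite indicE mem_set // /= in_itv /= !extE.
  by have := kx i; rewrite !mxE => -[-> ->].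
rewrite leeDr //; apply: sume_ge0 => k' _; rewrite mul1e lee_fin.
exact: prodr_ge0.
Qed.

(** Of the [(q+1)^(n+1)] cells of side [1/(q+1)], the one indexed by [f] is missed; the others cover
    [S] with total volume below 1. *)
Lemma leb_outer_le_grid (R : realType) (n q : nat) (f : {ffun 'I_n.+1 -> 'I_q.+1})
    (S : set (vec R n.+1)) :
  S `<=` @torus R n.+1 ->
  (forall x, S x -> ~ (forall i, (f i)%:R <= q.+1%:R * x i 0 < (f i).+1%:R)) ->
  (leb_outer S < 1)%E.
Proof.
move=> St Sf; pose s := enum (predC1 f).
have ss : size s = (q.+1 ^ n.+1).-1.
  by rewrite -cardE cardC1 card_ffun !card_ord.
pose Q : R := q.+1%:R; have Q0 : 0 < Q by rewrite ltr0n.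
(* Past the end of the list of cells the boxes are empty. *)
pose a k : vec R n.+1 := \col_i (if (k < size s)%N then (nth f s k i)%:R / Q else 0).
pose b k : vec R n.+1 := \col_i (a k i 0 + (if (k < size s)%N then Q^-1 else 0)).
have volk k : vol (a k) (b k) = if (k < size s)%N then Q^-1 ^+ n.+1 else 0.
  rewrite /vol (eq_bigr (fun=> if (k < size s)%N then Q^-1 else 0)).
    by rewrite prodr_const card_ord; case: ifP => // _; rewrite expr0n.
  move=> i _; rewrite !mxE addrAC subrr add0r; case: ifP => _.
    by apply/max_idPr; rewrite invr_ge0 ltW.
  by rewrite maxxx.
apply: (@le_lt_trans _ _ (\sum_(0 <= k <oo) (vol (a k) (b k))%:E)%E).
  apply: ereal_inf_lbound; exists a, b; split=> // x Sx.
  pose g := [ffun i => inord (Num.truncn (Q * x i 0)) : 'I_q.+1].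
  have gE i : (g i)%:R <= Q * x i 0 < (g i).+1%:R.
    have [x0 x1] := St x Sx i.
    have Qx0 : 0 <= Q * x i 0 by rewrite mulr_ge0 // ltW.
    have /andP[t0 t1] := truncn_itv Qx0.
    rewrite ffunE inordK ?t0 // -(ltr_nat R); apply: le_lt_trans t0 _.
    by rewrite -[ltRHS]mulr1 ltr_pM2l.
  have gs : g \in s.
    by rewrite mem_enum inE; apply/eqP => gf; apply: (Sf x Sx) => i; rewrite -gf.
  exists (index g s) => // i; rewrite !mxE index_mem gs nth_index //.
  have /andP[g1 g2] := gE i; split; first by rewrite ler_pdivrMr // mulrC.
  by rewrite -[X in _ + X]mul1r -mulrDl ltr_pdivlMr // mulrC natr1.
rewrite (nneseries_split 0 (size s)); last first.
  by move=> k _; rewrite volk lee_fin; case: ifP => // _; rewrite exprn_ge0 // invr_ge0 ltW.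
rewrite eseries0 ?adde0; last first.
  by move=> k; rewrite add0n => sk _; rewrite volk ltnNge sk.
rewrite add0n big_mkord (eq_bigr (fun=> (Q^-1 ^+ n.+1)%:E)); last first.
  by move=> k _; rewrite volk ltn_ord.
rewrite sumEFin sumr_const card_ord ss lte_fin -mulr_natl.
rewrite exprVn ltr_pdivrMr ?exprn_gt0 // mul1r -natrX ltr_nat.
by rewrite prednK // expn_gt0.
Qed.

(** * Integral linear forms modulo 1 and aperiodicity *)

Section LinearForm.
Variables (R : realType) (n : nat).
Implicit Types (v : 'rV[int]_n) (x : vec R n).

Definition lin_form v x : R := (map_mx intr v *m x) 0 0.

Lemma lin_form_tmap (A : 'M[int]_n) v x :
  exists z : int, lin_form v (tmap A x) = lin_form (v *m A) x + z%:~R.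
Proof.
pose y : vec R n := map_mx (fun z : int => z%:~R) A *m x.
exists (- (v *m (map_mx (@Num.floor R) y)) 0 0).
rewrite /lin_form /tmap -/y.
have -> : map_mx (@fract R) y = y - map_mx intr (map_mx (@Num.floor R) y).
  by apply/matrixP => i j; rewrite !mxE.
by rewrite mulmxBr -map_mxM mulmxA -map_mxM /= mxE [X in _ + X]mxE [X in _ - X]mxE rmorphN.
Qed.

Lemma norm_lin_form v x (l : R) : (forall i, `|x i 0| <= l) ->
  `|lin_form v x| <= (mxnorm1 v)%:R * l.
Proof.
move=> h; rewrite /lin_form mxE; apply: le_trans (ler_norm_sum _ _ _) _.
rewrite /mxnorm1 big_ord1 natr_sum mulr_suml; apply: ler_sum => i _.
rewrite normrM !mxE; apply: ler_pM => //.
by rewrite -intr_norm -abszE pmulrn.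
Qed.

Definition boxes : set (set (vec R n)) := [set B | exists a b, B = box a b].

Lemma measurable_coord (i : 'I_n) :
  measurable_fun (setT : set (g_sigma_algebraType boxes))
    ((fun x => x i 0) : g_sigma_algebraType boxes -> R).
Proof.
apply: (measurability _ (RGenCInfty.measurableE R)) => //.
move=> _ [_ [r ->] <-]; rewrite setTI.
(* The half-space where coordinate [i] is at least [r] is exhausted by countably many boxes. *)
pose a (N : nat) : vec R n := \col_j (if j == i then r else - N%:R).
pose b (N : nat) : vec R n := const_mx N%:R.
have -> : (fun x : vec R n => x i 0) @^-1` `[r, +oo[ = \bigcup_N box (a N) (b N).
  apply/seteqP; split=> x /=; rewrite in_itv /= andbT; last first.
    by case=> N _ /(_ i) []; rewrite !mxE eqxx.
  move=> rx; pose N := (\sum_j Num.bound `|x j ord0|%R)%N.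
  have xN j : `|x j 0| < N%:R.
    apply: lt_le_trans (archi_boundP (normr_ge0 _)) _.
    by rewrite ler_nat /N (bigD1 j) //= leq_addr.
  exists N => // j; rewrite !mxE.
  have := xN j; rewrite ltr_norml => /andP[/ltW h1 h2]; split=> //.
  by case: eqP => [->|].
apply: bigcupT_measurable => N; apply: sub_sigma_algebra.
by exists (a N), (b N).
Qed.

Lemma measurable_lin_form v :
  measurable_fun (setT : set (g_sigma_algebraType boxes))
    (lin_form v : g_sigma_algebraType boxes -> R).
Proof.
have -> : lin_form v = (fun x => \sum_i (v 0 i)%:~R * x i 0).
  by apply/funext => x; rewrite /lin_form mxE; apply: eq_bigr => i _; rewrite mxE.
apply: measurable_sum => i; apply: measurable_funM; first exact: measurable_cst.
exact: measurable_coord.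
Qed.

End LinearForm.

Lemma ergodic_aperiodic (R : realType) (n : nat) (A : 'M[int]_n) :
  (1 <= n)%N -> ergodic_torus R A ->
  forall t, (0 < t)%N -> \det (A ^+ t - 1) != 0.
Proof.
case: n A => // n A _ erg t t0; apply/negP => /det0P [u u0].
rewrite mulmxBr mulmx1 => /eqP; rewrite subr_eq0 => /eqP uA.
pose U j := u *m A ^+ j.
pose near_int v (x : vec R n.+1) := exists z : int, `|lin_form v x - z%:~R| < 8^-1.
pose S : set (vec R n.+1) :=
  [set x | torus x /\ forall j, (j < t)%N -> near_int (U j) x].
have near_tmap j x : near_int (U j) (tmap A x) <-> near_int (U j.+1) x.
  have [z0 e] := lin_form_tmap A (U j) x.
  have eU : U j *m A = U j.+1 by rewrite /U exprSr -mulmxA.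
  rewrite eU in e; split=> -[z hz].
    by exists (z - z0); rewrite rmorphB /= opprB addrA -e.
  by exists (z + z0); rewrite e rmorphD /= opprD addrACA subrr addr0.
(* [tmap] shifts the forms [U j] modulo integers, and the shift closes up after [t] steps, so a
   condition on all of them is invariant. *)
have Ut : U t = U 0%N by rewrite /U uA expr0 mulmx1.
have Sinv x : torus x -> S (tmap A x) <-> S x.
  move=> tx; split=> -[_ h]; split=> //.
  - case=> [|j] jt; last by apply/near_tmap/h/ltnW.
    by rewrite -Ut -(prednK t0); apply/near_tmap/h; rewrite prednK.
  - move=> i; rewrite mxE /fract.
    have /andP[f1 f2] := floor_itv ((map_mx intr A *m x) i 0).
    by rewrite subr_ge0 f1 ltrBlDr addrC -[1]/(1%:~R) -intrD f2.
  - move=> j jt; apply/near_tmap; move: (jt); rewrite leq_eqVlt => /orP[/eqP ->|]; last exact: h.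
    by rewrite Ut; apply: h.
have Sborel : borel_set S.
  pose V j : set (vec R n.+1) := if (j < t)%N then
    \bigcup_(z : int) lin_form (U j) @^-1` `]z%:~R - 8^-1, z%:~R + 8^-1[ else setT.
  have -> : S = box (const_mx 0) (const_mx 1) `&` \bigcap_j V j.
    apply/seteqP; split=> x /= [tx h].
      split=> [i|j _]; first by rewrite !mxE; apply: tx.
      rewrite /V; case: ifPn => // /h [z hz]; exists z => //=.
      by rewrite in_itv /= -ltr_distlC distrC.
    split=> [i|j jt]; first by have := tx i; rewrite !mxE.
    have := h j I; rewrite /V jt => -[z _ /=]; rewrite in_itv /= => hz.
    by exists z; rewrite distrC ltr_distlC.
  suff : measurable (box (const_mx 0) (const_mx 1) `&` \bigcap_j V j :
      set (g_sigma_algebraType (@boxes R n.+1))) by [].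
  apply: measurableI.
    by apply: sub_sigma_algebra; exists (const_mx 0), (const_mx 1).
  apply: bigcapT_measurable => j; rewrite /V; case: ifP => // _.
  apply: countable_bigcupT_measurable => // z.
  have := @measurable_lin_form R n.+1 (U j) measurableT _
    (measurable_itv `]z%:~R - 8^-1, z%:~R + 8^-1[).
  by rewrite setTI.
have [S0|S1] := erg S (fun x => @proj1 _ _) Sborel Sinv.
  (* On the cube of side [1/K] at the origin every [U j] has absolute value below 1/8. *)
  pose K : nat := (8 * (\sum_(j < t) mxnorm1 (U j)).+1)%N.
  have K0 : 0 < K%:R^-1 :> R by rewrite invr_gt0 ltr0n.
  have [] : ~ (forall x : vec R n.+1, (forall i, 0 <= x i 0 < K%:R^-1) -> S x).
    by move=> /(leb_outer_ge_cube K0); rewrite S0 lee_fin leNgt exprn_gt0.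
  move=> x hx; split=> [i|j jt].
    have /andP[x0 x1] := hx i; split=> //; apply: lt_le_trans x1 _.
    by rewrite invf_le1 ?ltr0n // ler1n.
  exists 0; rewrite subr0; apply: le_lt_trans (@norm_lin_form _ _ _ _ K%:R^-1 _) _.
    by move=> i; have /andP[x0 /ltW x1] := hx i; rewrite ger0_norm.
  rewrite ltr_pdivrMr ?ltr0n // /K natrM mulKf ?pnatr_eq0 // ltr_nat ltnS.
  by rewrite (bigD1 (Ordinal jt)) //= leq_addr.
have [i0 ui0] : exists i, u 0 i != 0.
  apply/existsP; apply: contraNT u0 => /existsPn h.
  by apply/eqP/rowP => i; rewrite mxE; apply/eqP; have := h i; rewrite negbK.
(* The missed cell has its corner at [1/(2m)] in direction [i0] and 0 elsewhere, where [u] takes the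
   value 1/2 or -1/2. With side [1/(16 m M)], the index is [8 M] and [u] varies by at most 1/16 on
   the cell. *)
pose m := `|u ord0 i0|%N; pose M := mxnorm1 u.
have m0 : (0 < m)%N by rewrite absz_gt0.
have mM : (m <= M)%N by apply: leq_entry_mxnorm1.
have M0 : (0 < M)%N by apply: leq_trans mM.
pose q := (16 * m * M).-1.
have qE : q.+1 = (16 * m * M)%N by rewrite prednK // !muln_gt0 m0.
pose c := [ffun i => if i == i0 then inord (8 * M) else 0 : 'I_q.+1].
have cE i : c i = (if i == i0 then 8 * M else 0)%N :> nat.
  rewrite ffunE; case: eqP => // _; rewrite inordK // qE.
  rewrite (_ : (16 * m * M = 8 * M * (2 * m))%N); last by ring.
  by rewrite ltn_Pmulr ?muln_gt0 // (leq_mul (leqnn 2) m0).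
have : (leb_outer S < 1)%E; last by rewrite S1 ltxx.
apply: (@leb_outer_le_grid R n q c) => [x []//|x [_ /(_ 0%N t0)] [z hz] hx].
pose x0 : vec R n.+1 := \col_i (if i == i0 then (2 * m%:R)^-1 else 0).
have mR : m%:R != 0 :> R by rewrite pnatr_eq0 -lt0n.
have MR : M%:R != 0 :> R by rewrite pnatr_eq0 -lt0n.
have Q0 : 0 < q.+1%:R :> R by rewrite ltr0n.
have dx i : `|(x - x0) i 0| <= q.+1%:R^-1.
  rewrite !mxE; have e : (if i == i0 then (2 * m%:R)^-1 else 0) = (c i)%:R / q.+1%:R :> R.
    rewrite cE qE; case: ifP => _; last by rewrite mul0r.
    by rewrite !natrM; field; rewrite mR MR.
  have /andP[h1 h2] := hx i.
  rewrite e -(ler_pM2l Q0) -{1}(gtr0_norm Q0) -normrM mulrBr mulrCA.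
  rewrite !divff ?gt_eqF // mulr1 ger0_norm ?subr_ge0 // lerBlDr addrC.
  by rewrite natr1 ltW.
have lx0 : lin_form u x0 = (sgz (u 0 i0))%:~R / 2.
  rewrite /lin_form mxE (bigD1 i0) //= big1 ?addr0; last first.
    by move=> i ii0; rewrite !mxE (negPf ii0) mulr0.
  rewrite !mxE eqxx [in LHS](intEsg (u 0 i0)) rmorphM /= -/m pmulrn.
  by field; rewrite mR.
have dl : `|lin_form u x - lin_form u x0| <= 16^-1.
  have -> : lin_form u x - lin_form u x0 = lin_form u (x - x0).
    by rewrite /lin_form mulmxBr !mxE.
  apply: le_trans (norm_lin_form u dx) _.
  rewrite qE !natrM -/M ler_pdivrMr ?mulr_gt0 ?ltr0n // mulrA mulKf ?pnatr_eq0 //.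
  by rewrite ler_peMl ?ler0n // ler1n.
have U0 : U 0%N = u by rewrite /U expr0 mulmx1.
rewrite U0 in hz.
(* An odd integer cannot have absolute value below 1. *)
have : `|(sgz (u 0 i0) - 2 * z)%:~R| < 1 :> R.
  rewrite rmorphB rmorphM /=; move: hz dl; rewrite lx0 ltr_norml ler_norml ltr_norml.
  move: (lin_form u x) (sgz _)%:~R z%:~R => y s w.
  by move=> /andP[h1 h2] /andP[h3 h4]; apply/andP; split; lra.
rewrite -intr_norm -[1]/(1%:~R) ltr_int.
have := sgz_cp0 (u 0 i0); move: ui0.
case: sgzP => // _ _ _; lia.
Qed.

(** * Orbits of rational points *)

Section RationalOrbit.
Variables (R : realType) (n : nat) (A : 'M[int]_n) (N : nat) (w : 'cV[int]_n).
Hypotheses (N0 : (0 < N)%N) (coN : coprime N `|\det A|).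

Let NR : N%:R != 0 :> R.
Proof. by rewrite pnatr_eq0 -lt0n. Qed.

Definition orbit_point (i : nat) : vec R n :=
  \col_l fract (((A ^+ i *m w) l 0)%:~R / N%:R).

Lemma fract_addz (r : R) (z : int) : fract (r + z%:~R) = fract r.
Proof. by rewrite /fract floorDrz ?intr_int // intrKfloor rmorphD /= opprD addrACA subrr addr0. Qed.

Lemma fract_eqP (r s : R) : fract r = fract s <-> exists z : int, r - s = z%:~R.
Proof.
split=> [e|[z e]]; last by rewrite -(subrK s r) e addrC fract_addz.
exists (Num.floor r - Num.floor s); rewrite rmorphB /=.
move: e; rewrite /fract; set a := _%:~R; set b := _%:~R => e.
by rewrite -[r](subrK a) e addrAC [X in X + a]addrAC subrr add0r addrC.
Qed.

Lemma fract_itv (r : R) : 0 <= fract r /\ fract r < 1.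
Proof.
have /andP[f1 f2] := floor_itv r; rewrite /fract subr_ge0 ltrBlDr addrC.
by split=> //; rewrite -[1]/(1%:~R) -intrD.
Qed.

Lemma tmap_orbit_point i : tmap A (orbit_point i) = orbit_point i.+1.
Proof.
apply/matrixP => l j; rewrite ord1 [LHS]mxE [RHS]mxE; apply/fract_eqP.
exists (- \sum_k A l k * Num.floor (((A ^+ i *m w) k 0)%:~R / N%:R : R)).
rewrite rmorphN rmorph_sum exprS -mulmxA [in X in _ - X]mxE rmorph_sum mulr_suml mxE.
rewrite -sumrB -sumrN; apply: eq_bigr => k _; rewrite [X in X * _]mxE [X in _ * X]mxE.
by rewrite /fract !rmorphM /= mulrBr -mulrA addrAC subrr add0r.
Qed.

Lemma iter_orbit_point i : iter i (tmap A) (orbit_point 0) = orbit_point i.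
Proof. by elim: i => //= i ->; apply: tmap_orbit_point. Qed.

Lemma orbit_point_eqP i j :
  orbit_point i = orbit_point j <-> mxdvd N ((A ^+ i - A ^+ j) *m w).
Proof.
have sub_entry l : ((A ^+ i - A ^+ j) *m w) l 0 = (A ^+ i *m w) l 0 - (A ^+ j *m w) l 0.
  by rewrite mulmxBl mxE [X in _ + X]mxE.
split=> [/matrixP e l m|h].
  have := e l 0; rewrite [LHS]mxE [RHS]mxE => /fract_eqP [z].
  rewrite -mulrBl => /(canRL (mulfVK NR)); rewrite -rmorphB /= pmulrn -rmorphM /=.
  by move=> /intr_inj e'; rewrite ord1 sub_entry e' dvdz_mull.
apply/matrixP => l m; rewrite ord1 [LHS]mxE [RHS]mxE; apply/fract_eqP.
have /dvdzP [z hz] := h l 0; exists z.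
by rewrite -mulrBl -rmorphB /= -sub_entry hz rmorphM /= -pmulrn mulfK.
Qed.

(** [A] is invertible mod [N] because its determinant is coprime to [N]; hence the orbit is periodic
    and not merely eventually periodic. *)
Lemma mxdvd_cancel i s :
  mxdvd N ((A ^+ (i + s) - A ^+ i) *m w) -> mxdvd N ((A ^+ s - 1) *m w).
Proof.
have -> : A ^+ (i + s) - A ^+ i = A ^+ i *m (A ^+ s - 1%:M).
  by rewrite exprD mulmxBr mulmx1.
elim: i => [|i IH]; first by rewrite expr0 mul1mx.
rewrite exprS -mulmxA -mulmxA mulmxA => h; apply: IH; rewrite -mulmxA.
apply: (@mxdvd_coprimeZ _ _ _ (\det A)); first by rewrite coprimezE.
by apply: mxdvd_det; rewrite mulmxA mulmxA mulmxA in h *.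
Qed.

Lemma orbit_point_periodic : exists T, (0 < T)%N && `[< orbit_point T = orbit_point 0 >].
Proof.
have ltN i l : (`|((A ^+ i *m w) l ord0 %% N)%Z|%N < N.-1.+1)%N.
  by rewrite prednK // -ltz_nat gez0_abs ?modz_ge0 ?ltz_pmod ?eqz_nat -?lt0n.
(* Pigeonhole on the residues mod [N] of [A^i w]. *)
pose F := {ffun 'I_n -> 'I_N.-1.+1}.
pose f (i : 'I_#|F|.+1) : F := [ffun l => inord `|((A ^+ i *m w) l ord0 %% N)%Z|%N].
have [i [j ij fij]] : exists i, exists2 j, i != j & f i = f j.
  apply/injectivePn; apply/negP => /injectiveP /leq_card.
  by rewrite card_ord ltnn.
wlog lt_ij : i j ij fij / (i < j)%N.
  move=> h; have := ij; rewrite neq_ltn => /orP[|] l; first exact: (h i j).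
  by apply: (h j i) => //; rewrite eq_sym.
exists (j - i)%N; rewrite subn_gt0 lt_ij; apply/asboolP/orbit_point_eqP.
rewrite expr0; apply: (@mxdvd_cancel i); rewrite subnKC 1?ltnW //.
rewrite mulmxBl => l m; rewrite mxE [X in _ + X]mxE -eqz_mod_dvd ord1.
have := congr1 (fun g : F => val (g l)) fij; rewrite !ffunE /= !inordK ?ltN //.
move/eqP; rewrite -eqz_nat !gez0_abs ?modz_ge0 ?eqz_nat -?lt0n //.
by rewrite eq_sym.
Qed.

Lemma orbit_point_cycle T i : orbit_point T = orbit_point 0 ->
  orbit_point i = orbit_point (i %% T).
Proof.
move=> h; rewrite -(iter_orbit_point i) -(iter_orbit_point (i %% T)).
rewrite {1}(divn_eq i T) addnC iterD; congr (iter _ _ _).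
elim: (i %/ T)%N => [|q IH]; first by rewrite mul0n.
by rewrite mulSn addnC iterD iter_orbit_point h.
Qed.

(** Any lift of a difference of orbit points is [D / N] with [D] of the form in the hypothesis, and
    the sum of its [n] coordinates in absolute value is at most [n] times its Euclidean norm. For
    [T = 1] the infimum is over the empty set, hence the condition [1 < T]. *)
Lemma rational_orbit (K : nat) :
  (forall (e : int) (m t : nat) (z : 'cV[int]_n),
    e *: ((A ^+ (m + t) - A ^+ m) *m w) - N%:Z *: z != 0 ->
    (N <= K * mxnorm1 (e *: ((A ^+ (m + t) - A ^+ m) *m w) - N%:Z *: z))%N) ->
  exists T, [/\ (0 < T)%N, mxdvd N ((A ^+ T - 1) *m w),
    periodic_pt A (orbit_point 0), (torbit A (orbit_point 0) #= `I_T)%card &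
    (1 < T)%N -> (K * n)%:R^-1 <= orbit_dist (torbit A (orbit_point 0))].
Proof.
move=> sep.
have [T /andP[T0 /asboolP per] Tmin] := ex_minnP orbit_point_periodic.
have inj i j : (i < j)%N -> (j < T)%N -> orbit_point i <> orbit_point j.
  move=> ij jT /esym /orbit_point_eqP; rewrite -{1}(subnKC (ltnW ij)) => /mxdvd_cancel h.
  have := Tmin (j - i)%N; rewrite subn_gt0 ij /=; case: asboolP => [_ /(_ isT)|[]].
    by rewrite leqNgt (leq_ltn_trans (leq_subr _ _)).
  by apply/orbit_point_eqP.
have orbE : torbit A (orbit_point 0) = [set orbit_point i | i in `I_T].
  apply/seteqP; split=> _ [i _ <-]; rewrite ?iter_orbit_point.
    by exists (i %% T)%N; [rewrite /= ltn_pmod|rewrite -orbit_point_cycle].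
  by exists i; rewrite ?iter_orbit_point.
exists T; split=> //.
- by have /orbit_point_eqP := per.
- split; first by move=> i; rewrite mxE; apply: fract_itv.
  by exists T; rewrite iter_orbit_point.
- rewrite orbE; apply: inj_card_eq => i j; rewrite !inE /= => iT jT e.
  by case: (ltngtP i j) => // h; [case: (inj i j)|case: (inj j i)].
move=> T1; apply: lb_le_inf.
  exists (tdist (orbit_point 0) (orbit_point 1)), (orbit_point 0), (orbit_point 1).
  by rewrite orbE; split; [exists 0%N|split; [exists 1%N|split; [exact: inj|]]].
move=> _ [y [z [Oy [Oz [yz ->]]]]].
move: Oy Oz; rewrite orbE => -[i iT yi] [j jT zj].
apply: lb_le_inf.
  by exists (Num.sqrt (\sum_i (y i 0 - z i 0 - ((0 : 'cV[int]_n) i 0)%:~R) ^+ 2)), 0.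
move=> _ [m ->]; set s := \sum_l _.
pose fl i : 'cV[int]_n := \col_l Num.floor (((A ^+ i *m w) l 0)%:~R / N%:R : R).
pose D := (A ^+ i - A ^+ j) *m w - N%:Z *: (fl i - fl j + m).
have DE l : y l 0 - z l 0 - (m l 0)%:~R = (D l 0)%:~R / N%:R.
  rewrite /D mulmxBl -yi -zj !mxE /fract !rmorphB !rmorphM !rmorphD /= rmorphN /=.
  by rewrite -pmulrn; field; rewrite NR.
have D0 : D != 0.
  apply/eqP => D0; apply: yz; rewrite -yi -zj; apply/orbit_point_eqP.
  by apply/mxdvdP; exists (fl i - fl j + m); apply/eqP; rewrite -subr_eq0 -/D D0.
have ND : (N <= K * mxnorm1 D)%N.
  (* The multiplier [e] is 1 or -1 according to the order of [i] and [j]. *)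
  have [ji|/ltnW ij] := leqP j i.
    have := sep 1 j (i - j)%N (fl i - fl j + m); rewrite scale1r subnKC // -/D.
    exact.
  have := sep (-1) i (j - i)%N (fl i - fl j + m); rewrite subnKC // scaleN1r.
  by rewrite -mulNmx opprB -/D; apply.
have s0 : 0 <= s by apply: sumr_ge0 => l _; apply: sqr_ge0.
have Ds l : `|(D l 0)%:~R / N%:R : R| <= Num.sqrt s.
  rewrite -sqrtr_sqr ler_wsqrtr // /s (bigD1 l) //= DE lerDl.
  by apply: sumr_ge0 => l' _; apply: sqr_ge0.
have : (mxnorm1 D)%:R / N%:R <= n%:R * Num.sqrt s.
  have -> : n%:R * Num.sqrt s = \sum_(l < n) Num.sqrt s.
    by rewrite sumr_const card_ord mulr_natl.
  rewrite /mxnorm1 natr_sum mulr_suml.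
  apply: ler_sum => l _; rewrite big_ord1; apply: le_trans (Ds l).
  by rewrite normrM normfV normr_nat -intr_norm -abszE pmulrn.
have n0 : (0 < n)%N.
  by move: D0; case: (n) (D) => // D' /eqP []; apply/matrixP => [[]].
have K0 : (0 < K)%N by move: ND; case: (K) => //; rewrite mul0n leqNgt N0.
move=> h; rewrite natrM invfM ler_pdivrMr ?ltr0n // [leRHS]mulrC.
apply: le_trans h; rewrite ler_pdivlMr ?ltr0n // mulrC ler_pdivrMr ?ltr0n //.
by rewrite -natrM ler_nat mulnC.
Qed.

End RationalOrbit.

(** * The sequence of orbits *)

Theorem theorem1p1 (R : realType) (n : nat) (A : 'M[int]_n) :
  (1 <= n)%N -> \det A != 0 -> ergodic_torus R A ->
  exists C : R, 0 < C /\
  exists (x : nat -> vec R n) (T : nat -> nat),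
    (forall k, periodic_pt A (x k)) /\
    (forall k, (torbit A (x k) #= `I_(T k))%card) /\
    (forall k, C <= orbit_dist (torbit A (x k)) ^+ n * (T k)%:R) /\
    (forall M : nat, exists K : nat, forall k, (K <= k)%N -> (M <= T k)%N).
Proof.
move=> n0 dA erg.
have dA0 : (0 < `|\det A|)%N by rewrite absz_gt0.
(* Taking [B] to be the absolute value of [\det A] makes [N] coprime to the determinant. *)
have [c spaced] := spaced_orbits dA (ergodic_aperiodic n0 erg) dA0.
have c0 : (0 < c)%N.
  have [N [M [w [[_ _ _ + _] _]]]] := spaced 1%N isT.
  by rewrite exp1n; case: (c) => //; rewrite mul0n.
have cR : 0 < c%:R :> R by rewrite ltr0n.
have nR : 0 < n%:R :> R by rewrite ltr0n.
(* The distance is at least [1/(c Q n)] and the period at least [Q^n / c]; the powers of [Q]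
   cancel. *)
exists ((c * n)%:R^-1 ^+ n / c%:R); split.
  by rewrite divr_gt0 // exprn_gt0 // invr_gt0 natrM mulr_gt0.
have step k : exists p : vec R n * nat, [/\ periodic_pt A p.1,
    (torbit A p.1 #= `I_p.2)%card,
    (c * n)%:R^-1 ^+ n / c%:R <= orbit_dist (torbit A p.1) ^+ n * p.2%:R &
    (k <= c * p.2)%N].
  (* Since [Q <= Q^n <= c T], the summand [2 * c] forces [T > 1] and the summand [k] makes the
     periods tend to infinity. *)
  pose Q := (k + 2 * c)%N; have Q0 : (0 < Q)%N by rewrite addn_gt0 muln_gt0 c0 orbT.
  have [N [M [w [[N0 coN _ QM Mt] sep]]]] := spaced Q Q0.
  have [T [T0 wT per card dist]] := rational_orbit R N0 coN sep.
  have MT : (M <= T)%N by rewrite dvdn_leq // Mt.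
  have QnT : (Q ^ n <= c * T)%N by rewrite (leq_trans QM) // leq_mul2l MT orbT.
  have QT : (Q <= c * T)%N.
    by apply: leq_trans QnT; rewrite -{1}(expn1 Q) leq_pexp2l.
  have T1 : (1 < T)%N.
    rewrite -(leq_pmul2l c0) mulnC; apply: leq_trans QT; exact: leq_addl.
  exists (orbit_point R A N w 0, T); split=> //=; last first.
    by apply: leq_trans QT; apply: leq_addr.
  have d0 : 0 <= (c * Q * n)%:R^-1 :> R by rewrite invr_ge0 ler0n.
  apply: (@le_trans _ _ ((c * Q * n)%:R^-1 ^+ n * T%:R)); last first.
    by rewrite ler_wpM2r ?ler0n // lerXn2r ?nnegrE ?dist // (le_trans d0) ?dist.
  have QR : 0 < Q%:R :> R by rewrite ltr0n.
  have -> : (c * Q * n)%:R^-1 = (c * n)%:R^-1 * Q%:R^-1 :> R.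
    by rewrite mulnAC natrM invfM.
  rewrite exprMn -mulrA; apply: ler_wpM2l.
    by rewrite exprn_ge0 // invr_ge0 ler0n.
  rewrite exprVn mulrC ler_pdivlMr ?exprn_gt0 // mulrC ler_pdivrMr // -natrX -natrM.
  by rewrite ler_nat mulnC.
have [f hf] := choice step.
exists (fun k => (f k).1), (fun k => (f k).2).
split; first by move=> k; case: (hf k).
split; first by move=> k; case: (hf k).
split; first by move=> k; case: (hf k).
move=> M; exists (c * M)%N => k ck; have [_ _ _ kT] := hf k.
by rewrite -(leq_pmul2l c0) (leq_trans ck).
Qed.
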